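(* Let $\varphi(z)=1+B_1z+B_2z^2+B_3z^3+\cdots$ be a Ma–Minda function and let $f\in\mathcal{S}^*(\varphi)$. Then the following hold. (1) $1-B_1^2\le \det T_{2,1}(f)\le 1$. (2) If $3B_1^4-8B_1^2+2B_1^2B_2-B_2^2<0$ and $B_1\le |B_2+B_1^2|$, then $\det T_{3,1}(f)\le 1$. (3) If $3B_1^4-8B_1^2+2B_1^2B_2-B_2^2\ge 0$ and $B_1\le |B_2+B_1^2|$, then $$\det T_{3,1}(f)\le B_1^2(B_1^2+B_2)-\frac14\left(B_1^2+B_2\right)^2-2B_1^2+1.$$ All these inequalities are sharp.
   Context: $\mathbb{D}=\{z\in\mathbb{C}:|z|<1\}$. $\mathcal{A}$ is the class of analytic functions $f(z)=z+a_2z^2+a_3z^3+\cdots$ on $\mathbb{D}$. A Ma–Minda function is an analytic univalent function $\varphi$ on $\mathbb{D}$ with positive real part, $\varphi(0)=1$, $\varphi'(0)>0$, such that $\varphi(\mathbb{D})$ is starlike with respect to $1$ and symmetric about the real axis (so the coefficients $B_n$ are real and $B_1>0$). $\mathcal{S}^*(\varphi)=\{f\in\mathcal{A}: zf'(z)/f(z)\prec\varphi(z)\}$, where $\prec$ denotes subordination: $h\prec\varphi$ means $h=\varphi\circ\omega$ for some analytic $\omega:\mathbb{D}\to\mathbb{D}$ with $\omega(0)=0$. For $f(z)=z+a_2z^2+a_3z^3+\cdots$, the second and third order Hermitian–Toeplitz determinants are $$\det T_{2,1}(f)=1-|a_2|^2,\qquad \det T_{3,1}(f)=\begin{vmatrix}1&a_2&a_3\\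 \bar a_2&1&a_2\\ \bar a_3&\bar a_2&1\end{vmatrix}=2\,\mathrm{Re}(a_2^2\bar a_3)-2|a_2|^2-|a_3|^2+1.$$ An inequality is sharp if, for each $\varphi$ satisfying its hypotheses, equality is attained by some function in the class. *)

(* Defs.v *)
(* Stdlib world: Stdlib's R with Coquelicot's complex numbers C. *)
From Stdlib Require Import Reals.
From Coquelicot Require Import Coquelicot.
Open Scope R_scope.

Definition unit_disk (z : C) : Prop := Cmod z < 1.

Definition analytic_at (f : C -> C) (z0 : C) : Prop :=
  exists (c : nat -> C) (r : R), 0 < r /\
    forall z : C, Cmod (z - z0)%C < r -> is_pseries c (z - z0)%C (f z).

Definition analytic_on_disk (f : C -> C) : Prop :=
  forall z : C, unit_disk z -> analytic_at f z.

(* [c] is the coefficient sequence of the Maclaurin expansion of [f], which is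
   required to converge to [f] on the whole disk. *)
Definition expansion_on_disk (f : C -> C) (c : nat -> C) : Prop :=
  forall z : C, unit_disk z -> is_pseries c z (f z).

Definition disk_image (f : C -> C) (w : C) : Prop :=
  exists z : C, unit_disk z /\ f z = w.

Definition univalent (f : C -> C) : Prop :=
  forall z w : C, unit_disk z -> unit_disk w -> f z = f w -> z = w.

Definition starlike_wrt (S : C -> Prop) (w0 : C) : Prop :=
  forall (w : C) (t : R), S w -> 0 <= t <= 1 ->
    S ((1 - RtoC t) * w0 + RtoC t * w)%C.

Definition symmetric_real_axis (S : C -> Prop) : Prop :=
  forall w : C, S w -> S (Cconj w).

Record ma_minda (phi : C -> C) : Prop := {
  mm_analytic : analytic_on_disk phi;
  mm_univalent : univalent phi;
  mm_Re_pos : forall z : C, unit_disk z -> 0 < Re (phi z);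
  mm_at_0 : phi (RtoC 0) = RtoC 1;
  mm_derive_0 : exists d : R, 0 < d /\ is_derive phi (RtoC 0) (RtoC d);
  mm_starlike : starlike_wrt (disk_image phi) (RtoC 1);
  mm_symmetric : symmetric_real_axis (disk_image phi)
}.

Definition subordinate (h phi : C -> C) : Prop :=
  exists omega : C -> C,
    analytic_on_disk omega /\ omega (RtoC 0) = RtoC 0 /\
    (forall z : C, unit_disk z -> unit_disk (omega z)) /\
    (forall z : C, unit_disk z -> h z = phi (omega z)).

Definition class_A (f : C -> C) : Prop :=
  analytic_on_disk f /\ f (RtoC 0) = RtoC 0 /\ is_derive f (RtoC 0) (RtoC 1).

(* z f'(z) / f(z), with its removable singularity at 0 filled in: for f in
   class A the limit there is 1. *)
Definition log_derivative (f : C -> C) (z : C) : C :=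
  if Ceq_dec z (RtoC 0) then RtoC 1 else (z * C_derive f z / f z)%C.

(* Division in C is total, so it must be said explicitly that z f'(z) / f(z)
   has no pole in the disk. *)
Definition S_star (phi f : C -> C) : Prop :=
  class_A f /\
  (forall z : C, unit_disk z -> z <> RtoC 0 -> f z <> RtoC 0) /\
  subordinate (log_derivative f) phi.

Definition det2 (m11 m12 m21 m22 : C) : C := (m11 * m22 - m12 * m21)%C.

Definition det3 (m11 m12 m13 m21 m22 m23 m31 m32 m33 : C) : C :=
  (m11 * det2 m22 m23 m32 m33
   - m12 * det2 m21 m23 m31 m33
   + m13 * det2 m21 m22 m31 m32)%C.

Definition detT21 (a : nat -> C) : C :=
  det2 (RtoC 1)          (a 2%nat)
       (Cconj (a 2%nat)) (RtoC 1).

Definition detT31 (a : nat -> C) : C :=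
  det3 (RtoC 1)          (a 2%nat)         (a 3%nat)
       (Cconj (a 2%nat)) (RtoC 1)          (a 2%nat)
       (Cconj (a 3%nat)) (Cconj (a 2%nat)) (RtoC 1).

(* These determinants are real, so nothing is lost in comparing their real
   parts with real bounds. *)
Lemma detT21E (a : nat -> C) :
  detT21 a = RtoC (1 - Cmod (a 2%nat) ^ 2).
Proof.
rewrite RtoC_minus, Cmod2_conj; unfold detT21, det2; ring.
Qed.

Lemma detT31E (a : nat -> C) :
  detT31 a =
    RtoC (2 * Re (a 2%nat ^ 2 * Cconj (a 3%nat))%C
          - 2 * Cmod (a 2%nat) ^ 2 - Cmod (a 3%nat) ^ 2 + 1).
Proof.
rewrite RtoC_plus, !RtoC_minus, !RtoC_mult, !Cmod2_conj, re_alt.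
rewrite Cmult_conj, Cpow_conj, Cconj_conj.
unfold detT31, det3, det2; field.
Qed.

(* Main.v *)
Require Import Defs.
From Stdlib Require Import Reals.
From Coquelicot Require Import Coquelicot.
From Stdlib Require Import Lra Lia Psatz Classical ClassicalEpsilon.
Open Scope R_scope.

(** Why the theorem holds.

    Write z f'/f = phi o omega with omega(z) = c1 z + c2 z^2 + ...  Comparing
    coefficients gives a2 = B1 c1 and 2 a3 = B1 c2 + (B2 + B1^2) c1^2
    ([S_star_coefficients]).  The Schwarz and Schwarz--Pick inequalities say
    that |c1| <= 1 and |c2| <= 1 - |c1|^2 ([schwarz_pick]).  The second order
    bounds only say that 0 <= |a2| <= B1.

    For the third order determinant, completing the square gives
    det T31 = (1 - |a2|^2)^2 - |a3 - a2^2|^2 ([Re_detT31]).  With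
    x = |c1|^2, b = B1 and m = |B1^2 - B2| / 2 the first term is
    (1 - b^2 x)^2, and the triangle inequality bounds |a3 - a2^2| below by
    m x - b (1 - x) / 2 ([S_star_detT31]).  So the determinant is at most a
    function of x in [0, 1] alone, and it remains to see that this function
    is largest at x = 0 or at x = 1, where it takes the values 1 and
    (1 - b^2)^2 - m^2.  A quarter of the polynomial whose sign is
    assumed is b^4 - 2 b^2 - m^2, the difference of these two values, so that
    this sign decides which one is the larger.  That no interior x does better
    uses b <= 2, which follows from Re phi > 0 ([coef1_le_2_of_Re_pos]); the
    comparison is made in [det_envelope_le_value_at_0] and
    [det_envelope_le_value_at_1].

    Sharpness: x = 0 is attained by f(z) = z, where omega = 0, and x = 1 by
    the f with z f'/f = phi, where omega(z) = z.  The latter is z G(z) with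
    G' = ((phi - 1)/z) G and G(0) = 1; its power series is built from the
    recurrence for the coefficients ([exists_with_log_derivative]).

    Two pieces of complex analysis carry this.  For existence, power series
    on the unit disk are treated through growth conditions on their
    coefficients; recentring and differentiation both come from division by
    z - z0.  For the Schwarz lemma only finite Taylor expansions at each point
    are used: if |g|^2 + eps |z|^2 had an interior local maximum, its mean over
    four points z0 + s i^k would contradict it for small s, and this gives the
    maximum principle without integration ([max_modulus]). *)

(** * Series of complex numbers *)

Lemma pow_n_Cpow (z : C) (n : nat) : pow_n z n = (z ^ n)%C.
Proof.
  induction n as [|n IH]; [reflexivity|].
  change (z * pow_n z n = z * z ^ n)%C; now rewrite IH.
Qed.

Lemma is_pseries_C (a : nat -> C) (z l : C) :
  is_pseries a z l <-> is_series (fun n => (a n * z ^ n)%C) l.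
Proof.
  assert (H : forall n, (pow_n z n * a n = a n * z ^ n)%C).
  { intro n; rewrite pow_n_Cpow; apply Cmult_comm. }
  split; apply is_series_ext; intro n; [exact (H n) | exact (eq_sym (H n))].
Qed.

Lemma Re_sum_n (u : nat -> C) (n : nat) :
  Re (sum_n u n) = sum_n (fun k => Re (u k)) n.
Proof.
  induction n as [|n IH]; [now rewrite !sum_O|].
  rewrite !sum_Sn, <- IH; easy.
Qed.

Lemma Im_sum_n (u : nat -> C) (n : nat) :
  Im (sum_n u n) = sum_n (fun k => Im (u k)) n.
Proof.
  induction n as [|n IH]; [now rewrite !sum_O|].
  rewrite !sum_Sn, <- IH; easy.
Qed.

(** The uniform structure of C is that of R x R, so the theory of real series
    applies to each coordinate. *)
Lemma is_series_Re_Im (u : nat -> C) (l : C) :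
  is_series u l <->
  is_series (fun n => Re (u n)) (Re l) /\ is_series (fun n => Im (u n)) (Im l).
Proof.
  unfold is_series; split.
  - intro H; split.
    + apply (filterlim_ext (fun n => Re (sum_n u n))).
      { intro n; apply Re_sum_n. }
      intros P [e He]; specialize (H (fun z => P (Re z))); apply H.
      exists e; intros z [Hz _]; now apply He.
    + apply (filterlim_ext (fun n => Im (sum_n u n))).
      { intro n; apply Im_sum_n. }
      intros P [e He]; specialize (H (fun z => P (Im z))); apply H.
      exists e; intros z [_ Hz]; now apply He.
  - intros [H1 H2] P [e He].
    specialize (H1 (fun x => ball (Re l) e x) (locally_ball _ e)).
    specialize (H2 (fun x => ball (Im l) e x) (locally_ball _ e)).
    destruct H1 as [N1 H1], H2 as [N2 H2]; exists (max N1 N2); intros n Hn.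
    apply He; split.
    + specialize (H1 n ltac:(lia)); rewrite <- Re_sum_n in H1; exact H1.
    + specialize (H2 n ltac:(lia)); rewrite <- Im_sum_n in H2; exact H2.
Qed.

Lemma Cmod_is_series_le (u : nat -> C) (v : nat -> R) (l : C) (s : R) :
  (forall n, Cmod (u n) <= v n) -> is_series u l -> is_series v s -> Cmod l <= s.
Proof.
  intros Huv Hu Hv.
  assert (Hs : forall n, Cmod (sum_n u n) <= sum_n v n).
  { intro n; induction n as [|n IH]; [rewrite !sum_O; apply Huv|].
    rewrite !sum_Sn; eapply Rle_trans; [apply Cmod_triangle|].
    apply Rplus_le_compat; auto. }
  assert (Hlim : is_lim_seq (fun n => Cmod (sum_n u n)) (Cmod l)).
  { eapply filterlim_comp; [exact Hu|]. exact (filterlim_norm l). }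
  exact (is_lim_seq_le _ _ (Finite (Cmod l)) (Finite s) Hs Hlim Hv).
Qed.

Lemma is_series_bounded (u : nat -> C) (l : C) :
  is_series u l -> exists M, forall n, Cmod (u n) <= M.
Proof.
  intro H; apply is_series_Re_Im in H; destruct H as [H1 H2].
  assert (Hb : forall v : nat -> R, ex_series v -> exists M, forall n, Rabs (v n) <= M).
  { intros v Hv; apply ex_series_lim_0 in Hv.
    destruct (filterlim_bounded v) as [M HM]; [now exists 0|].
    now exists M. }
  destruct (Hb _ (ex_intro _ _ H1)) as [M1 HM1].
  destruct (Hb _ (ex_intro _ _ H2)) as [M2 HM2].
  exists (sqrt 2 * (M1 + M2)); intro n.
  eapply Rle_trans; [apply Cmod_2Rmax|].
  apply Rmult_le_compat_l; [apply sqrt_pos|].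
  specialize (HM1 n); specialize (HM2 n).
  pose proof (Rabs_pos (Re (u n))); pose proof (Rabs_pos (Im (u n))).
  apply Rmax_lub; unfold Re, Im in *; lra.
Qed.

Lemma ex_series_C_le (u : nat -> C) (v : nat -> R) :
  (forall n, Cmod (u n) <= v n) -> ex_series v -> exists l, is_series u l.
Proof. intros H Hv; exact (@ex_series_le _ C_CompleteNormedModule u v H Hv). Qed.

Lemma is_series_C_ext (u v : nat -> C) (l : C) :
  (forall n, u n = v n) -> is_series u l -> is_series v l.
Proof. exact (is_series_ext u v l). Qed.

Lemma is_series_C_plus (u v : nat -> C) (k l : C) :
  is_series u k -> is_series v l -> is_series (fun n => (u n + v n)%C) (k + l)%C.
Proof. exact (is_series_plus u v k l). Qed.

Lemma is_series_C_scal (c : C) (u : nat -> C) (l : C) :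
  is_series u l -> is_series (fun n => (c * u n)%C) (c * l)%C.
Proof. exact (is_series_scal c u l). Qed.

Lemma Re_mult (z w : C) : Re (z * w) = Re z * Re w - Im z * Im w.
Proof. reflexivity. Qed.
Lemma Im_mult (z w : C) : Im (z * w) = Re z * Im w + Im z * Re w.
Proof. reflexivity. Qed.

(** The Cauchy product of two complex series is a combination of four Cauchy
    products of their real and imaginary parts. *)
Lemma is_series_C_mult (u v : nat -> C) (k l : C) :
  is_series u k -> is_series v l ->
  ex_series (fun n => Cmod (u n)) -> ex_series (fun n => Cmod (v n)) ->
  is_series (fun n => sum_n (fun j => (u j * v (n - j)%nat)%C) n) (k * l)%C.
Proof.
  intros Hu Hv Au Av.
  apply is_series_Re_Im in Hu; apply is_series_Re_Im in Hv.
  destruct Hu as [Hu1 Hu2], Hv as [Hv1 Hv2].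
  assert (HR : forall w : nat -> C, ex_series (fun n => Cmod (w n)) ->
     ex_series (fun n => Rabs (Re (w n)))).
  { intros w Hw; eapply (@ex_series_le _ R_CompleteNormedModule); [|exact Hw].
    intro n; unfold norm; simpl; unfold abs; simpl; rewrite Rabs_Rabsolu.
    apply re_le_Cmod. }
  assert (HI : forall w : nat -> C, ex_series (fun n => Cmod (w n)) ->
     ex_series (fun n => Rabs (Im (w n)))).
  { intros w Hw; eapply (@ex_series_le _ R_CompleteNormedModule); [|exact Hw].
    intro n; unfold norm; simpl; unfold abs; simpl; rewrite Rabs_Rabsolu.
    eapply Rle_trans; [apply Rmax_r|apply Rmax_Cmod]. }
  apply is_series_Re_Im; split.
  - rewrite Re_mult.
    eapply is_series_ext; [|apply (is_series_minus _ _ _ _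
      (is_series_mult _ _ _ _ Hu1 Hv1 (HR _ Au) (HR _ Av))
      (is_series_mult _ _ _ _ Hu2 Hv2 (HI _ Au) (HI _ Av)))].
    intro n; rewrite Re_sum_n, sum_n_Reals.
    symmetry; exact (minus_sum _ _ n).
  - rewrite Im_mult.
    eapply is_series_ext; [|apply (is_series_plus _ _ _ _
      (is_series_mult _ _ _ _ Hu1 Hv2 (HR _ Au) (HI _ Av))
      (is_series_mult _ _ _ _ Hu2 Hv1 (HI _ Au) (HR _ Av)))].
    intro n; rewrite Im_sum_n, sum_n_Reals.
    symmetry; exact (plus_sum _ _ n).
Qed.

(** * Power series on the disk and their recentring *)

Definition geometric (r M : R) (a : nat -> C) : Prop :=
  forall n, Cmod (a n) * r ^ n <= M.

(** This amounts to a radius of convergence of at least 1 (see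
    [expansion_subgeometric] and [psum_expansion]), stated on the coefficients
    so that it can be followed through operations on them. *)
Definition subgeometric (a : nat -> C) : Prop :=
  forall r, 0 < r < 1 -> exists M, geometric r M a.

(** Real [Series] is total, so the sum needs no proof of convergence. *)
Definition psum (a : nat -> C) (z : C) : C :=
  (Series (fun n => Re (a n * z ^ n)%C), Series (fun n => Im (a n * z ^ n)%C)).

Lemma geometric_terms (r M : R) (a : nat -> C) (z : C) :
  0 < r -> geometric r M a ->
  forall n, Cmod (a n * z ^ n) <= M * (Cmod z / r) ^ n.
Proof.
  intros HR Ha n; rewrite Cmod_mult, Cmod_pow.
  assert (HRn : 0 < r ^ n) by now apply pow_lt.
  replace (Cmod (a n) * Cmod z ^ n)
    with ((Cmod (a n) * r ^ n) * (Cmod z / r) ^ n).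
  - apply Rmult_le_compat_r; [|apply Ha].
    apply pow_le, Rdiv_le_0_compat; [apply Cmod_ge_0 | easy].
  - unfold Rdiv; rewrite Rpow_mult_distr, pow_inv; field; lra.
Qed.

Lemma geometric_ratio (r : R) (z : C) :
  0 < r -> Cmod z < r -> Rabs (Cmod z / r) < 1.
Proof.
  intros HR Hz; pose proof (Cmod_ge_0 z).
  rewrite Rabs_pos_eq; [|now apply Rdiv_le_0_compat].
  apply Rlt_div_l; lra.
Qed.

Lemma geometric_abs_convergent (r M : R) (a : nat -> C) (z : C) :
  0 < r -> geometric r M a -> Cmod z < r ->
  ex_series (fun n => Cmod (a n * z ^ n)).
Proof.
  intros HR Ha Hz.
  apply (@ex_series_le _ R_CompleteNormedModule _ (fun n => M * (Cmod z / r) ^ n)).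
  - intro n; unfold norm; simpl; unfold abs; simpl.
    rewrite Rabs_pos_eq by apply Cmod_ge_0; now apply geometric_terms.
  - apply (ex_series_scal_l M (fun n => (Cmod z / r) ^ n)).
    now apply ex_series_geom, geometric_ratio.
Qed.

Lemma is_series_psum (r M : R) (a : nat -> C) (z : C) :
  0 < r -> geometric r M a -> Cmod z < r ->
  is_series (fun n => a n * z ^ n)%C (psum a z).
Proof.
  intros HR Ha Hz.
  destruct (ex_series_C_le (fun n => a n * z ^ n)%C (fun n => M * (Cmod z / r) ^ n))
    as [l Hl].
  - now apply geometric_terms.
  - apply (ex_series_scal_l M (fun n => (Cmod z / r) ^ n)).
    now apply ex_series_geom, geometric_ratio.
  - replace (psum a z) with l; [easy|].
    apply is_series_Re_Im in Hl; destruct Hl as [H1 H2].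
    unfold psum; rewrite (is_series_unique _ _ H1), (is_series_unique _ _ H2).
    now destruct l.
Qed.

Lemma psum_unique (a : nat -> C) (z l : C) :
  is_series (fun n => a n * z ^ n)%C l -> psum a z = l.
Proof.
  intro Hl; apply is_series_Re_Im in Hl; destruct Hl as [H1 H2].
  unfold psum; rewrite (is_series_unique _ _ H1), (is_series_unique _ _ H2).
  now destruct l.
Qed.

Lemma psum_ext (a b : nat -> C) (z : C) :
  (forall n, a n = b n) -> psum a z = psum b z.
Proof.
  intro H; unfold psum; f_equal; apply Series_ext; intro n; now rewrite H.
Qed.

Lemma Cmod_psum_le (r M : R) (a : nat -> C) (z : C) :
  0 < r -> geometric r M a -> Cmod z < r ->
  Cmod (psum a z) <= M * (r / (r - Cmod z)).
Proof.
  intros HR Ha Hz.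
  eapply Cmod_is_series_le; [now apply (geometric_terms r M)|now apply (is_series_psum r M)|].
  replace (r / (r - Cmod z)) with (/ (1 - Cmod z / r)) by (field; lra).
  apply (is_series_scal_l M (fun n => (Cmod z / r) ^ n)), is_series_geom.
  now apply geometric_ratio.
Qed.

Lemma geometric_shift (r M : R) (a : nat -> C) (k : nat) :
  0 < r -> geometric r M a -> geometric r (M / r ^ k) (fun n => a (k + n)%nat).
Proof.
  intros HR Ha n; assert (HRk : 0 < r ^ k) by now apply pow_lt.
  apply (Rle_div_r _ _ _ HRk).
  specialize (Ha (k + n)%nat); rewrite pow_add in Ha; lra.
Qed.

Lemma psum_shift (r M : R) (a : nat -> C) (z : C) :
  0 < r -> geometric r M a -> Cmod z < r ->
  psum a z = (a 0%nat + z * psum (fun n => a (S n)) z)%C.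
Proof.
  intros HR Ha Hz; apply psum_unique, is_series_decr_1.
  replace (plus _ _) with (z * psum (fun n => a (S n)) z)%C.
  2: { change (plus ?x (opp ?y)) with (x + - y)%C. simpl Cpow; ring. }
  eapply is_series_C_ext; [|apply is_series_C_scal,
     (is_series_psum r (M / r ^ 1) (fun n => a (S n)) z HR); [|easy]].
  - intro n; simpl; ring.
  - exact (geometric_shift r M a 1 HR Ha).
Qed.

(** Synthetic division: the coefficients of the quotient of a(z) - a(z0) by
    z - z0, a power series in z again, see [psum_quot]. *)
Definition quot_coef (z0 : C) (a : nat -> C) (n : nat) : C :=
  psum (fun m => a (S n + m)%nat) z0.

Lemma quot_coef_rec (r M : R) (z0 : C) (a : nat -> C) (n : nat) :
  0 < r -> geometric r M a -> Cmod z0 < r ->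
  a (S n) = (quot_coef z0 a n - z0 * quot_coef z0 a (S n))%C.
Proof.
  intros HR Ha Hz; unfold quot_coef.
  rewrite (psum_shift r (M / r ^ (S n)) (fun m => a (S n + m)%nat));
    [|easy|now apply geometric_shift|easy].
  replace (S n + 0)%nat with (S n) by lia.
  rewrite (psum_ext (fun m => a (S n + S m)%nat) (fun m => a (S (S n) + m)%nat)).
  - ring.
  - intro m; f_equal; lia.
Qed.

(** Division by z - z0 keeps the radius r and costs a factor 1 / (r - |z0|) in
    the constant; iterated, this is what makes Taylor series converge. *)
Lemma quot_coef_geometric (r M : R) (z0 : C) (a : nat -> C) :
  0 < r -> geometric r M a -> Cmod z0 < r ->
  geometric r (M / (r - Cmod z0)) (quot_coef z0 a).
Proof.
  intros HR Ha Hz n; unfold quot_coef.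
  assert (HRn : 0 < r ^ n) by now apply pow_lt.
  pose proof (Cmod_psum_le r _ _ z0 HR (geometric_shift r M a (S n) HR Ha) Hz) as H.
  apply (Rmult_le_compat_r (r ^ n)) in H; [|lra].
  eapply Rle_trans; [exact H|]; apply Req_le; simpl; field; lra.
Qed.

Lemma psum_quot (r M : R) (z0 : C) (a : nat -> C) (z : C) :
  0 < r -> geometric r M a -> Cmod z0 < r -> Cmod z < r ->
  psum a z = (psum a z0 + (z - z0) * psum (quot_coef z0 a) z)%C.
Proof.
  intros HR Ha Hz0 Hz; set (b := quot_coef z0 a).
  assert (Hb : geometric r (M / (r - Cmod z0)) b) by now apply quot_coef_geometric.
  rewrite (psum_shift r M a z), (psum_shift r M a z0) by easy.
  assert (E : psum (fun n => a (S n)) z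
     = (psum b z - z0 * psum (fun n => b (S n)) z)%C).
  { apply psum_unique.
    replace (psum b z - z0 * psum (fun n => b (S n)) z)%C
      with (psum b z + (- z0) * psum (fun n => b (S n)) z)%C by ring.
    eapply is_series_C_ext; [|apply is_series_C_plus;
      [exact (is_series_psum r _ b z HR Hb Hz)
      |apply is_series_C_scal,
        (is_series_psum r (M / (r - Cmod z0) / r ^ 1) (fun n => b (S n)))]].
    - intro n; simpl; rewrite (quot_coef_rec r M z0 a n HR Ha Hz0); fold b; ring.
    - exact HR.
    - exact (geometric_shift r _ b 1 HR Hb).
    - exact Hz. }
  rewrite E, (psum_shift r _ b z HR Hb Hz).
  change (psum (fun n => a (S n)) z0) with (b 0%nat); ring.
Qed.

Fixpoint quot_iter (z0 : C) (a : nat -> C) (k : nat) : nat -> C :=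
  match k with O => a | S k => quot_coef z0 (quot_iter z0 a k) end.

Lemma quot_iter_geometric (r M : R) (z0 : C) (a : nat -> C) (k : nat) :
  0 < r -> geometric r M a -> Cmod z0 < r ->
  geometric r (M / (r - Cmod z0) ^ k) (quot_iter z0 a k).
Proof.
  intros HR Ha Hz; induction k as [|k IH].
  - intro n; simpl; rewrite Rdiv_1_r; apply Ha.
  - simpl; replace (M / ((r - Cmod z0) * (r - Cmod z0) ^ k))
      with (M / (r - Cmod z0) ^ k / (r - Cmod z0)).
    + now apply quot_coef_geometric.
    + field; split; [apply pow_nonzero|]; lra.
Qed.

(** Dividing k times by z - z0 and evaluating at z0 gives the k-th Taylor
    coefficient at z0. *)
Definition taylor_coef (a : nat -> C) (z0 : C) (k : nat) : C :=
  psum (quot_iter z0 a k) z0.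

Lemma psum_taylor_partial (r M : R) (z0 : C) (a : nat -> C) (z : C) (N : nat) :
  0 < r -> geometric r M a -> Cmod z0 < r -> Cmod z < r ->
  psum a z = (sum_n (fun k => taylor_coef a z0 k * (z - z0) ^ k) N
              + (z - z0) ^ S N * psum (quot_iter z0 a (S N)) z)%C.
Proof.
  intros HR Ha Hz0 Hz; induction N as [|N IH].
  - rewrite sum_O, (psum_quot r M z0 a z) by easy.
    unfold taylor_coef; simpl; ring.
  - rewrite sum_Sn, IH; change (plus ?x ?y) with (x + y)%C.
    rewrite (psum_quot r _ z0 (quot_iter z0 a (S N)) z HR
      (quot_iter_geometric r M z0 a (S N) HR Ha Hz0) Hz0 Hz).
    fold (taylor_coef a z0 (S N)); simpl; ring.
Qed.

Lemma is_series_C_Cmod (u : nat -> C) (l : C) :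
  is_lim_seq (fun n => Cmod (sum_n u n - l)%C) 0 -> is_series u l.
Proof.
  intro H; apply filterlim_locally; intro eps.
  apply is_lim_seq_spec in H; destruct (H eps) as [N HN]; exists N.
  intros n Hn; specialize (HN n Hn).
  apply C_NormedModule_mixin_compat1.
  rewrite Rminus_0_r, Rabs_pos_eq in HN by apply Cmod_ge_0; exact HN.
Qed.

Lemma is_series_C_0 : is_series (fun _ : nat => RtoC 0) (RtoC 0).
Proof.
  apply is_series_C_Cmod.
  apply is_lim_seq_ext with (fun _ => 0); [|apply is_lim_seq_const].
  intro n; replace (sum_n (fun _ => RtoC 0) n) with (RtoC 0).
  - unfold Cminus; rewrite Cplus_opp_r, Cmod_0; easy.
  - induction n as [|n IH]; [now rewrite sum_O|].
    rewrite sum_Sn, <- IH; symmetry; apply Cplus_0_r.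
Qed.

(** After N + 1 divisions the remainder is (z - z0)^(N+1) times a power series
    bounded by a constant times (r - |z0|)^-(N+1), hence geometrically small.
    This recentres the series without interchanging a double sum. *)
Lemma is_pseries_taylor (r M : R) (z0 : C) (a : nat -> C) (z : C) :
  0 < r -> geometric r M a -> Cmod z0 < r -> Cmod (z - z0) < r - Cmod z0 ->
  is_pseries (taylor_coef a z0) (z - z0)%C (psum a z).
Proof.
  intros HR Ha Hz0 Hh.
  assert (Hz : Cmod z < r).
  { replace z with (z0 + (z - z0))%C by ring.
    eapply Rle_lt_trans; [apply Cmod_triangle|lra]. }
  apply is_pseries_C, is_series_C_Cmod.
  set (q := Cmod (z - z0) / (r - Cmod z0)).
  assert (Hq : 0 <= q < 1).
  { split; [apply Rdiv_le_0_compat; [apply Cmod_ge_0|lra]|apply Rlt_div_l; lra]. }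
  set (K := M * (r / (r - Cmod z)) * q).
  apply (is_lim_seq_le_le (fun _ => 0) _ (fun N => K * q ^ N)).
  - intro N; split; [apply Cmod_ge_0|].
    rewrite (psum_taylor_partial r M z0 a z N) by easy.
    match goal with |- Cmod ?x <= _ => replace x with
      (- ((z - z0) ^ S N * psum (quot_iter z0 a (S N)) z))%C by ring end.
    rewrite Cmod_opp, Cmod_mult, Cmod_pow.
    eapply Rle_trans.
    + apply Rmult_le_compat_l; [apply pow_le, Cmod_ge_0|].
      apply (Cmod_psum_le r _ _ z HR (quot_iter_geometric r M z0 a (S N) HR Ha Hz0) Hz).
    + apply Req_le; unfold K, q, Rdiv; simpl; rewrite !Rpow_mult_distr, !pow_inv.
      field; repeat split; try lra. apply pow_nonzero; lra.
  - apply is_lim_seq_const.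
  - replace (Finite 0) with (Rbar_mult K 0) by (simpl; f_equal; ring).
    apply is_lim_seq_scal_l, is_lim_seq_geom.
    rewrite Rabs_pos_eq; lra.
Qed.

Lemma expansion_subgeometric (F : C -> C) (a : nat -> C) :
  expansion_on_disk F a -> subgeometric a.
Proof.
  intros HF r HR.
  assert (HR1 : unit_disk (RtoC r)).
  { unfold unit_disk; rewrite Cmod_R, Rabs_pos_eq; lra. }
  specialize (HF _ HR1); apply is_pseries_C, is_series_bounded in HF.
  destruct HF as [M HM]; exists M; intro n; specialize (HM n).
  rewrite Cmod_mult, Cmod_pow, Cmod_R, Rabs_pos_eq in HM; lra.
Qed.

Lemma expansion_psum (F : C -> C) (a : nat -> C) (z : C) :
  expansion_on_disk F a -> unit_disk z -> F z = psum a z.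
Proof. intros HF Hz; symmetry; apply psum_unique, is_pseries_C, HF, Hz. Qed.

Lemma unit_disk_0 : unit_disk (RtoC 0).
Proof. unfold unit_disk; rewrite Cmod_0; lra. Qed.

Lemma disk_radius (z : C) : unit_disk z -> exists r, 0 < r < 1 /\ Cmod z < r.
Proof.
  unfold unit_disk; intro Hz; pose proof (Cmod_ge_0 z).
  exists ((1 + Cmod z) / 2); lra.
Qed.

Lemma psum_expansion (a : nat -> C) :
  subgeometric a -> expansion_on_disk (psum a) a.
Proof.
  intros Ha z Hz; apply is_pseries_C.
  destruct (disk_radius z Hz) as (r & HR & HzR); destruct (Ha r HR) as [M HM].
  now apply (is_series_psum r M).
Qed.

Lemma expansion_analytic (F : C -> C) (a : nat -> C) :
  expansion_on_disk F a -> analytic_on_disk F.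
Proof.
  intros HF z0 Hz0; destruct (disk_radius z0 Hz0) as (r & HR & HzR).
  destruct (expansion_subgeometric F a HF r HR) as [M HM].
  exists (taylor_coef a z0), (r - Cmod z0); split; [lra|].
  intros z Hz.
  assert (Hz1 : unit_disk z).
  { unfold unit_disk; replace z with (z0 + (z - z0))%C by ring.
    eapply Rle_lt_trans; [apply Cmod_triangle|lra]. }
  rewrite (expansion_psum F a z HF Hz1).
  apply (is_pseries_taylor r M); lra || easy.
Qed.

(** * Differentiation, products and uniqueness of coefficients *)

Lemma is_derive_quadratic (F : C -> C) (z l : C) (d K : R) :
  0 < d ->
  (forall w, Cmod (w - z) < d -> Cmod (F w - F z - (w - z) * l) <= K * Cmod (w - z) ^ 2) ->
  is_derive F z l.
Proof.
  intros Hd H; split; [apply is_linear_scal_l|].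
  intros x Hx; rewrite <- (is_filter_lim_locally_unique _ _ Hx); clear x Hx.
  intro eps.
  assert (He : 0 < Rmin d (eps / (Rabs K + 1))).
  { pose proof (Rabs_pos K); apply Rmin_pos; [easy|].
    apply Rdiv_lt_0_compat; [apply cond_pos|lra]. }
  exists (mkposreal _ He); intros w Hw.
  change (Cmod (w - z) < Rmin d (eps / (Rabs K + 1))) in Hw.
  change (Cmod (F w - F z - (w - z) * l) <= eps * Cmod (w - z)).
  assert (Hw1 : Cmod (w - z) < d) by (eapply Rlt_le_trans; [exact Hw|apply Rmin_l]).
  assert (Hw2 : Cmod (w - z) < eps / (Rabs K + 1))
    by (eapply Rlt_le_trans; [exact Hw|apply Rmin_r]).
  eapply Rle_trans; [now apply H|].
  pose proof (Cmod_ge_0 (w - z)); pose proof (Rabs_pos K); pose proof (Rle_abs K).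
  apply Rlt_div_r in Hw2; [|lra].
  replace (K * Cmod (w - z) ^ 2) with (K * Cmod (w - z) * Cmod (w - z)) by ring.
  apply Rmult_le_compat_r; nra.
Qed.

Definition deriv_coef (a : nat -> C) (n : nat) : C := (INR (S n) * a (S n))%C.

Lemma subgeometric_deriv (a : nat -> C) : subgeometric a -> subgeometric (deriv_coef a).
Proof.
  intros Ha r Hr.
  (* r (1 + s) is the midpoint of r and 1; Bernoulli's inequality for (1 + s)^n
     absorbs the factor n + 1. *)
  set (s := (1 - r) / (2 * r)).
  assert (Hs : 0 < s) by (apply Rdiv_lt_0_compat; lra).
  assert (Hrs : r * (1 + s) = (1 + r) / 2) by (unfold s; field; lra).
  destruct (Ha (r * (1 + s)) ltac:(lra)) as [M HM].
  exists (M * (1 + / s) / r); intro n; unfold deriv_coef.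
  rewrite Cmod_mult, Cmod_R, Rabs_pos_eq by apply pos_INR.
  specialize (HM (S n)); rewrite Rpow_mult_distr in HM.
  pose proof (poly n s Hs) as HB.
  assert (Hn : INR (S n) <= (1 + / s) * (1 + s) ^ S n).
  { pose proof (pos_INR n); rewrite S_INR.
    apply Rle_trans with ((1 + / s) * (1 + INR n * s)).
    - replace ((1 + / s) * (1 + INR n * s)) with (1 + / s + INR n * s + INR n)
        by (field; lra).
      assert (0 < / s) by now apply Rinv_0_lt_compat.
      assert (0 <= INR n * s) by (apply Rmult_le_pos; lra). lra.
    - apply Rmult_le_compat_l.
      { assert (0 < / s) by now apply Rinv_0_lt_compat. lra. }
      eapply Rle_trans; [exact HB|]; simpl.
      assert (0 < (1 + s) ^ n) by (apply pow_lt; lra). nra. }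
  apply (Rle_div_r _ _ _ (ltac:(lra) : r > 0)).
  assert (Hr' : 0 < r ^ S n) by (apply pow_lt; lra).
  pose proof (Cmod_ge_0 (a (S n))).
  apply Rle_trans with (((1 + / s) * (1 + s) ^ S n) * (Cmod (a (S n)) * r ^ S n)).
  - replace (INR (S n) * Cmod (a (S n)) * r ^ n * r)
      with (INR (S n) * (Cmod (a (S n)) * r ^ S n)) by (simpl; ring).
    apply Rmult_le_compat_r; [|easy]. apply Rmult_le_pos; lra.
  - replace ((1 + / s) * (1 + s) ^ S n * (Cmod (a (S n)) * r ^ S n))
      with ((1 + / s) * (Cmod (a (S n)) * (r ^ S n * (1 + s) ^ S n))) by ring.
    rewrite (Rmult_comm M); apply Rmult_le_compat_l; [|exact HM].
    assert (0 < / s) by now apply Rinv_0_lt_compat. lra.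
Qed.

Lemma subgeometric_shift (a : nat -> C) :
  subgeometric a -> subgeometric (fun n => a (S n)).
Proof.
  intros Ha r Hr; destruct (Ha r Hr) as [M HM].
  exists (M / r ^ 1); exact (geometric_shift r M a 1 (proj1 Hr) HM).
Qed.

Lemma subgeometric_lin (c : C) (a b : nat -> C) :
  subgeometric a -> subgeometric b -> subgeometric (fun n => a n + c * b n)%C.
Proof.
  intros Ha Hb r Hr; destruct (Ha r Hr) as [M HM], (Hb r Hr) as [N HN].
  exists (M + Cmod c * N); intro n.
  specialize (HM n); specialize (HN n).
  pose proof (Cmod_triangle (a n) (c * b n)) as HT; rewrite Cmod_mult in HT.
  assert (0 < r ^ n) by (apply pow_lt; lra).
  pose proof (Cmod_ge_0 c); nra.
Qed.

Lemma is_series_psum_disk (a : nat -> C) (z : C) :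
  subgeometric a -> unit_disk z -> is_series (fun n => a n * z ^ n)%C (psum a z).
Proof. intros Ha Hz; now apply is_pseries_C, psum_expansion. Qed.

Lemma psum_lin (c : C) (a b : nat -> C) (z : C) :
  subgeometric a -> subgeometric b -> unit_disk z ->
  psum (fun n => a n + c * b n)%C z = (psum a z + c * psum b z)%C.
Proof.
  intros Ha Hb Hz; apply psum_unique.
  eapply is_series_C_ext; [|apply is_series_C_plus; [now apply is_series_psum_disk|
    apply is_series_C_scal; now apply is_series_psum_disk]].
  intro n; simpl; ring.
Qed.

Lemma psum_decr (a : nat -> C) (z : C) :
  subgeometric a -> unit_disk z ->
  psum a z = (a 0%nat + z * psum (fun n => a (S n)) z)%C.
Proof.
  intros Ha Hz; destruct (disk_radius z Hz) as (r & Hr & Hzr).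
  destruct (Ha r Hr) as [M HM]; apply (psum_shift r M); easy || lra.
Qed.

(** Let b be the quotient of a by division at z.  Then F'(z) is the sum of b at
    z.  The recurrence a_(n+1) = b_n - z b_(n+1) turns the formal derivative of
    a, evaluated at w, into b(w) + (w - z) b'(w), so it has the same value at
    w = z. *)
Lemma is_derive_expansion (F : C -> C) (a : nat -> C) (z : C) :
  expansion_on_disk F a -> unit_disk z -> is_derive F z (psum (deriv_coef a) z).
Proof.
  intros HF Hz; destruct (disk_radius z Hz) as (r & Hr & Hzr).
  pose proof (expansion_subgeometric F a HF) as Ha.
  set (b := quot_coef z a).
  assert (Hb : subgeometric b).
  { intros r' Hr'.
    (* The quotient is controlled for radii above |z| only, and smaller radii
       follow by monotonicity. *)
    set (m := Rmax r r').
    assert (Hm : r <= m /\ r' <= m /\ m < 1)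
      by (unfold m; repeat split; [apply Rmax_l|apply Rmax_r|apply Rmax_lub_lt; lra]).
    destruct (Ha m ltac:(lra)) as [M HM].
    exists (M / (m - Cmod z)); intro n.
    eapply Rle_trans; [|apply (quot_coef_geometric m M z a); [lra|easy|lra]].
    apply Rmult_le_compat_l; [apply Cmod_ge_0|apply pow_incr; lra]. }
  assert (Hd : psum (deriv_coef a) z = psum b z).
  { destruct (Ha r Hr) as [M HM].
    set (b' := deriv_coef b).
    assert (Hb' : subgeometric b') by now apply subgeometric_deriv.
    (* n b_n are the coefficients of w b'(w). *)
    transitivity (psum b z + z * psum b' z + (- z) * psum b' z)%C; [|ring].
    apply psum_unique.
    assert (H1 : is_series (fun n => INR n * b n * z ^ n)%C (z * psum b' z)%C).
    { apply is_series_decr_1.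
      replace (plus _ _) with (z * psum b' z)%C.
      2: { change (plus ?x (opp ?y)) with (x + - y)%C.
           change (INR 0) with 0; simpl Cpow; ring. }
      eapply is_series_C_ext; [|apply is_series_C_scal, (is_series_psum_disk b' z Hb' Hz)].
      intro n; unfold b', deriv_coef; rewrite Cpow_S. ring. }
    eapply is_series_C_ext; [|apply is_series_C_plus; [apply is_series_C_plus;
      [apply (is_series_psum_disk b z Hb Hz) | exact H1]|
       apply is_series_C_scal, (is_series_psum_disk b' z Hb' Hz)]].
    intro n; unfold b', deriv_coef; cbv beta.
    rewrite (quot_coef_rec r M z a n); [|lra|easy|easy]; fold b.
    rewrite S_INR, RtoC_plus; ring. }
  rewrite Hd.
  destruct (Ha r Hr) as [M HM].
  assert (HbM : geometric r (M / (r - Cmod z)) b) by (apply quot_coef_geometric; easy || lra).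
  set (N := M / (r - Cmod z) / (r - Cmod z)).
  assert (HcN : geometric r N (quot_coef z b)) by (apply quot_coef_geometric; easy || lra).
  apply (is_derive_quadratic F z _ ((r - Cmod z) / 2) (N * (2 * r / (r - Cmod z)))); [lra|].
  intros w Hw.
  assert (Hwr : Cmod w < r - (r - Cmod z) / 2).
  { replace w with (z + (w - z))%C by ring.
    eapply Rle_lt_trans; [apply Cmod_triangle|lra]. }
  assert (Hw1 : unit_disk w) by (unfold unit_disk; lra).
  rewrite (expansion_psum F a w HF Hw1), (expansion_psum F a z HF Hz).
  rewrite (psum_quot r M z a w) by (exact HM || lra); fold b.
  rewrite (psum_quot r _ z b w (proj1 Hr) HbM) by lra.
  match goal with |- Cmod ?x <= _ => replace x with
    ((w - z) ^ 2 * psum (quot_coef z b) w)%C by ring end.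
  rewrite Cmod_mult, Cmod_pow, Rmult_comm.
  apply Rmult_le_compat_r; [apply pow_le, Cmod_ge_0|].
  eapply Rle_trans; [apply (Cmod_psum_le r N); easy || lra|].
  assert (HN : 0 <= N).
  { eapply Rle_trans; [|apply (HcN 0%nat)].
    apply Rmult_le_pos; [apply Cmod_ge_0|apply pow_le; lra]. }
  apply Rmult_le_compat_l; [easy|].
  apply Rle_trans with (r / ((r - Cmod z) / 2)).
  - apply Rmult_le_compat_l; [lra|]; apply Rinv_le_contravar; lra.
  - apply Req_le; field; lra.
Qed.

Definition conv (a b : nat -> C) (n : nat) : C :=
  sum_n (fun j => a j * b (n - j)%nat)%C n.

Lemma expansion_conv (a b : nat -> C) :
  subgeometric a -> subgeometric b ->
  expansion_on_disk (fun z => psum a z * psum b z)%C (conv a b).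
Proof.
  intros Ha Hb z Hz; apply is_pseries_C.
  destruct (disk_radius z Hz) as (r & Hr & Hzr).
  destruct (Ha r Hr) as [M HM], (Hb r Hr) as [N HN].
  eapply is_series_C_ext; [|apply is_series_C_mult;
    [now apply is_series_psum_disk|now apply is_series_psum_disk|
     apply (geometric_abs_convergent r M); easy || lra|
     apply (geometric_abs_convergent r N); easy || lra]].
  intro n; unfold conv; cbv beta.
  rewrite <- (sum_n_mult_r (K := C_Ring) (z ^ n)%C).
  apply sum_n_ext_loc; intros j Hj.
  change (a j * z ^ j * (b (n - j)%nat * z ^ (n - j))
          = a j * b (n - j)%nat * z ^ n)%C.
  replace (z ^ n)%C with (z ^ j * z ^ (n - j))%C; [ring|].
  rewrite <- Cpow_add_r; f_equal; lia.
Qed.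

Lemma subgeometric_conv (a b : nat -> C) :
  subgeometric a -> subgeometric b -> subgeometric (conv a b).
Proof.
  intros Ha Hb; exact (expansion_subgeometric _ _ (expansion_conv a b Ha Hb)).
Qed.

Lemma psum_conv (a b : nat -> C) (z : C) :
  subgeometric a -> subgeometric b -> unit_disk z ->
  psum (conv a b) z = (psum a z * psum b z)%C.
Proof.
  intros Ha Hb Hz; symmetry.
  exact (expansion_psum _ _ z (expansion_conv a b Ha Hb) Hz).
Qed.

(** The form in which limits at 0 are taken below. *)
Lemma le_0_of_linear (x K d : R) :
  0 < d -> (forall t, 0 < t < d -> x <= K * t) -> x <= 0.
Proof.
  intros Hd H; destruct (Rle_or_lt x 0) as [|Hx]; [easy|exfalso].
  pose proof (Rabs_pos K); pose proof (Rle_abs K).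
  set (t := Rmin (d / 2) (x / (2 * (Rabs K + 1)))).
  assert (Ht0 : 0 < t).
  { apply Rmin_pos; [lra|]; apply Rdiv_lt_0_compat; lra. }
  assert (Ht1 : t <= d / 2) by apply Rmin_l.
  assert (Ht2 : t <= x / (2 * (Rabs K + 1))) by apply Rmin_r.
  specialize (H t ltac:(lra)).
  apply (Rle_div_r _ _ _ (ltac:(lra) : 2 * (Rabs K + 1) > 0)) in Ht2.
  nra.
Qed.

Lemma psum_zero_coef0 (a : nat -> C) :
  subgeometric a -> (forall z, unit_disk z -> z <> RtoC 0 -> psum a z = RtoC 0) ->
  a 0%nat = RtoC 0.
Proof.
  intros Ha Hz; apply Cmod_eq_0, Rle_antisym; [|apply Cmod_ge_0].
  destruct (subgeometric_shift a Ha (1/2) ltac:(lra)) as [M HM].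
  assert (HM0 : 0 <= M).
  { eapply Rle_trans; [|apply (HM 0%nat)].
    apply Rmult_le_pos; [apply Cmod_ge_0|apply pow_le; lra]. }
  apply (le_0_of_linear _ (2 * M) (1 / 4) ltac:(lra)); intros t Ht.
  assert (Ht1 : Cmod t = t) by (rewrite Cmod_R, Rabs_pos_eq; lra).
  assert (Htd : unit_disk t) by (unfold unit_disk; lra).
  pose proof (psum_decr a t Ha Htd) as E.
  rewrite Hz in E; [|easy|intro E0; apply RtoC_inj in E0; lra].
  replace (a 0%nat) with (- (t * psum (fun n => a (S n)) t))%C.
  2: { apply (f_equal (fun x => x - t * psum (fun n => a (S n)) t)%C) in E.
       ring_simplify in E; rewrite <- E; ring. }
  rewrite Cmod_opp, Cmod_mult, Ht1, Rmult_comm.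
  apply Rmult_le_compat_r; [lra|].
  eapply Rle_trans; [apply (Cmod_psum_le (1 / 2) M); easy || lra|].
  rewrite Ht1, (Rmult_comm 2 M); apply Rmult_le_compat_l; [easy|].
  apply Rle_div_l; lra.
Qed.

(** A zero constant term can be divided out, so that all coefficients vanish as
    soon as the constant term of every such series does. *)
Lemma psum_zero_coef (a : nat -> C) :
  subgeometric a -> (forall z, unit_disk z -> z <> RtoC 0 -> psum a z = RtoC 0) ->
  forall n, a n = RtoC 0.
Proof.
  intros Ha Hz n; revert a Ha Hz; induction n as [|n IH]; intros a Ha Hz.
  - now apply psum_zero_coef0.
  - apply (IH (fun n => a (S n))); [now apply subgeometric_shift|].
    intros z Hzd Hz0; pose proof (psum_decr a z Ha Hzd) as E.
    rewrite (Hz z Hzd Hz0), (psum_zero_coef0 a Ha Hz), Cplus_0_l in E.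
    destruct (Ceq_dec (psum (fun n => a (S n)) z) (RtoC 0)) as [|Hn]; [easy|].
    exfalso; symmetry in E; revert E; now apply Cmult_neq_0.
Qed.

(** * Functions with a prescribed logarithmic derivative *)

(** Row n lists the coefficients of index at most n and is only meaningful
    there; each row extends the previous one, so that a recurrence over all
    earlier terms becomes a structural recursion. *)
Fixpoint ode_table (c : nat -> C) (n : nat) : nat -> C :=
  match n with
  | O => fun _ => RtoC 1
  | S m => fun k =>
      if Nat.leb k m then ode_table c m k
      else (conv (ode_table c m) c m / INR (S m))%C
  end.

(** The power series solution of G' = c G with G(0) = 1. *)
Definition ode_coef (c : nat -> C) (n : nat) : C := ode_table c n n.

Lemma ode_table_coef (c : nat -> C) (n k : nat) :
  (k <= n)%nat -> ode_table c n k = ode_coef c k.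
Proof.
  induction n as [|n IH]; intro Hk; [now replace k with 0%nat by lia|].
  destruct (Nat.eq_dec k (S n)) as [->|Hne]; [reflexivity|].
  simpl; rewrite (proj2 (Nat.leb_le k n)) by lia; apply IH; lia.
Qed.

Lemma INR_S_neq_0 (n : nat) : RtoC (INR (S n)) <> RtoC 0.
Proof. intro E; apply RtoC_inj in E; now apply (not_0_INR (S n)). Qed.

Lemma ode_coef_spec (c : nat -> C) (n : nat) :
  deriv_coef (ode_coef c) n = conv (ode_coef c) c n.
Proof.
  unfold deriv_coef, ode_coef at 1; cbn [ode_table].
  rewrite (proj2 (Nat.leb_gt (S n) n)) by lia.
  replace (conv (ode_table c n) c n) with (conv (ode_coef c) c n).
  - field; apply INR_S_neq_0.
  - apply sum_n_ext_loc; intros k Hk; now rewrite ode_table_coef.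
Qed.

Lemma bounded_of_eventually_decreasing (y : nat -> R) (N : nat) :
  (forall n, (N <= n)%nat -> y (S n) <= y n) -> exists M, forall n, y n <= M.
Proof.
  revert y; induction N as [|N IH]; intros y Hy.
  - exists (y 0%nat); intro n; induction n as [|n IHn]; [lra|].
    specialize (Hy n ltac:(lia)); lra.
  - destruct (IH (fun n => y (S n))) as [M HM].
    { intros n Hn; apply Hy; lia. }
    exists (Rmax (y 0%nat) M); intros [|n]; [apply Rmax_l|].
    eapply Rle_trans; [apply HM|apply Rmax_r].
Qed.

Lemma Cmod_sum_n_le (u : nat -> C) (n : nat) :
  Cmod (sum_n u n) <= sum_n (fun k => Cmod (u k)) n.
Proof.
  induction n as [|n IH]; [rewrite !sum_O; lra|].
  rewrite !sum_Sn; eapply Rle_trans; [apply Cmod_triangle|].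
  apply Rplus_le_compat_r, IH.
Qed.

(** If |c_k| s^k <= M, the recurrence gives X_(n+1) <= X_n (1 + M/(n+1)) for
    the partial sums X_n of |g_j| s^j.  So X_n grows at most polynomially, and
    X_n q^n is eventually decreasing for every q < 1. *)
Lemma ode_coef_subgeometric (c : nat -> C) :
  subgeometric c -> subgeometric (ode_coef c).
Proof.
  intros Hc r Hr; set (g := ode_coef c).
  set (s := (1 + r) / 2); assert (Hs : 0 < r < s /\ s < 1) by (unfold s; lra).
  destruct (Hc s ltac:(lra)) as [M HM].
  assert (HM0 : 0 <= M).
  { eapply Rle_trans; [|apply (HM 0%nat)].
    apply Rmult_le_pos; [apply Cmod_ge_0|apply pow_le; lra]. }
  set (X := sum_f_R0 (fun j => Cmod (g j) * s ^ j)).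
  assert (Hx0 : forall j, 0 <= Cmod (g j) * s ^ j).
  { intro j; apply Rmult_le_pos; [apply Cmod_ge_0|apply pow_le; lra]. }
  assert (HX0 : forall n, 0 <= X n) by (intro n; apply cond_pos_sum, Hx0).
  assert (Hterm : forall n, Cmod (g n) * s ^ n <= X n).
  { intros [|n]; unfold X; cbn [sum_f_R0]; [apply Rle_refl|].
    specialize (HX0 n); unfold X in HX0; lra. }
  assert (Hstep : forall n, X (S n) <= X n * (1 + M / INR (S n))).
  { intro n; assert (HI : 0 < INR (S n)) by (apply lt_0_INR; lia).
    assert (H : INR (S n) * (Cmod (g (S n)) * s ^ S n) <= M * X n).
    { replace (INR (S n) * (Cmod (g (S n)) * s ^ S n))
        with (Cmod (deriv_coef g n) * s ^ S n).
      2: { unfold deriv_coef; rewrite Cmod_mult, Cmod_R, Rabs_pos_eq by lra; ring. }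
      unfold g; rewrite ode_coef_spec; fold g.
      eapply Rle_trans.
      { apply Rmult_le_compat_r; [apply pow_le; lra|apply Cmod_sum_n_le]. }
      rewrite sum_n_Reals, (Rmult_comm _ (s ^ S n)); unfold X.
      rewrite !scal_sum; apply sum_Rle; intros j Hj.
      rewrite Cmod_mult; specialize (HM (n - j)%nat).
      replace (s ^ S n) with (s * (s ^ j * s ^ (n - j))).
      2: { rewrite <- pow_add; simpl; do 2 f_equal; lia. }
      specialize (Hx0 j); pose proof (Cmod_ge_0 (c (n - j)%nat)).
      assert (0 <= s ^ (n - j)) by (apply pow_le; lra).
      replace (Cmod (g j) * Cmod (c (n - j)%nat) * (s * (s ^ j * s ^ (n - j))))
        with (Cmod (g j) * s ^ j * (s * (Cmod (c (n - j)%nat) * s ^ (n - j)))) by ring.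
      apply Rmult_le_compat_l; [easy|]; nra. }
    unfold X at 1; cbn [sum_f_R0]; fold (X n).
    rewrite Rmult_plus_distr_l, Rmult_1_r; apply Rplus_le_compat_l.
    replace (X n * (M / INR (S n))) with (M * X n / INR (S n)) by (field; lra).
    apply (Rle_div_r _ _ _ HI); simpl in *; lra. }
  set (q := r / s).
  assert (Hq : 0 < q < 1).
  { split; [apply Rdiv_lt_0_compat; lra|apply (Rlt_div_l r 1 s ltac:(lra)); lra]. }
  destruct (nfloor_ex (M * q / (1 - q))) as [N [_ HN]].
  { apply Rdiv_le_0_compat; nra. }
  destruct (bounded_of_eventually_decreasing (fun n => X n * q ^ n) N) as [K HK].
  { intros n Hn; simpl.
    assert (HI : INR N + 1 <= INR (S n)) by (rewrite S_INR; apply le_INR in Hn; lra).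
    pose proof (pos_INR N).
    assert (HMq : (1 + M / INR (S n)) * q <= 1).
    { apply (Rlt_div_l _ _ _ (ltac:(lra) : 1 - q > 0)) in HN.
      assert (M * q / INR (S n) <= 1 - q).
      { apply (Rle_div_l _ _ _ (ltac:(lra) : INR (S n) > 0)); nra. }
      replace ((1 + M / INR (S n)) * q) with (q + M * q / INR (S n)) by (field; lra).
      lra. }
    assert (Hqn : 0 <= q ^ n) by (apply pow_le; lra).
    specialize (HX0 n); specialize (Hstep n).
    apply Rle_trans with (X n * (1 + M / INR (S n)) * (q * q ^ n)).
    { apply Rmult_le_compat_r; [nra|easy]. }
    replace (X n * (1 + M / INR (S n)) * (q * q ^ n))
      with (X n * q ^ n * ((1 + M / INR (S n)) * q)) by ring.
    rewrite <- (Rmult_1_r (X n * q ^ n)) at 2.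
    apply Rmult_le_compat_l; [nra|easy]. }
  exists K; intro n; eapply Rle_trans; [|apply (HK n)].
  replace (r ^ n) with (s ^ n * q ^ n).
  - rewrite <- Rmult_assoc; apply Rmult_le_compat_r; [apply pow_le; lra|apply Hterm].
  - rewrite <- Rpow_mult_distr; f_equal; unfold q; field; lra.
Qed.

(** The operator z d/dz.  On convolutions it obeys the product rule without a
    shift of indices ([euler_conv]), since n = j + (n - j). *)
Definition euler_coef (a : nat -> C) (n : nat) : C := (INR n * a n)%C.

Lemma subgeometric_decr (a : nat -> C) :
  subgeometric (fun n => a (S n)) -> subgeometric a.
Proof.
  intros Ha r Hr; destruct (Ha r Hr) as [M HM].
  exists (Rmax (Cmod (a 0%nat)) (M * r)); intros [|n].
  - simpl; rewrite Rmult_1_r; apply Rmax_l.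
  - eapply Rle_trans; [|apply Rmax_r].
    replace (Cmod (a (S n)) * r ^ S n) with (Cmod (a (S n)) * r ^ n * r) by (simpl; ring).
    apply Rmult_le_compat_r; [lra|apply HM].
Qed.

Lemma subgeometric_euler (a : nat -> C) : subgeometric a -> subgeometric (euler_coef a).
Proof. intro Ha; apply subgeometric_decr; now apply subgeometric_deriv. Qed.

Lemma psum_euler (a : nat -> C) (z : C) :
  subgeometric a -> unit_disk z -> psum (euler_coef a) z = (z * psum (deriv_coef a) z)%C.
Proof.
  intros Ha Hz; rewrite (psum_decr (euler_coef a) z (subgeometric_euler a Ha) Hz).
  unfold euler_coef at 1; change (INR 0) with 0.
  change (fun n => euler_coef a (S n)) with (deriv_coef a); ring.
Qed.

Lemma euler_conv (a b : nat -> C) (n : nat) :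
  euler_coef (conv a b) n = (conv (euler_coef a) b n + 1 * conv a (euler_coef b) n)%C.
Proof.
  rewrite Cmult_1_l; unfold euler_coef at 1, conv.
  etransitivity; [symmetry; apply (sum_n_mult_l (K := C_Ring) (RtoC (INR n)))|].
  etransitivity; [|apply (sum_n_plus (G := C_Ring))].
  apply sum_n_ext_loc; intros j Hj; unfold euler_coef.
  change (INR n * (a j * b (n - j)%nat)
    = INR j * a j * b (n - j)%nat + a j * (INR (n - j) * b (n - j)%nat))%C.
  replace (RtoC (INR n)) with (INR j + INR (n - j))%C; [ring|].
  rewrite <- RtoC_plus, <- plus_INR; do 2 f_equal; lia.
Qed.

Lemma psum_deriv_ode (c : nat -> C) (z : C) :
  subgeometric c -> unit_disk z ->
  psum (deriv_coef (ode_coef c)) z = (psum (ode_coef c) z * psum c z)%C.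
Proof.
  intros Hc Hz; rewrite (psum_ext _ (conv (ode_coef c) c)).
  - now apply psum_conv; [apply ode_coef_subgeometric|..].
  - intro n; apply ode_coef_spec.
Qed.

(** As for the exponential function, the solution for -c is the inverse: the
    product P of the two satisfies z P' = 0, hence is the constant 1. *)
Lemma psum_ode_neq_0 (c : nat -> C) (z : C) :
  subgeometric c -> unit_disk z -> psum (ode_coef c) z <> RtoC 0.
Proof.
  intros Hc Hz.
  set (c' := fun n => (0 + (-1) * c n)%C).
  assert (Hc' : subgeometric c').
  { apply (subgeometric_lin (-1) (fun _ => RtoC 0)); [|easy].
    intros r Hr; exists 0; intro n; rewrite Cmod_0; lra. }
  assert (Ec' : forall w, unit_disk w -> psum c' w = (- psum c w)%C).
  { intros w Hw; apply psum_unique.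
    replace (- psum c w)%C with ((-1) * psum c w)%C by ring.
    eapply is_series_C_ext; [|apply is_series_C_scal, (is_series_psum_disk c w Hc Hw)].
    intro n; unfold c'; ring. }
  set (g := ode_coef c); set (e := ode_coef c').
  assert (Hg : subgeometric g) by now apply ode_coef_subgeometric.
  assert (He : subgeometric e) by now apply ode_coef_subgeometric.
  assert (Hge : subgeometric (conv g e)) by now apply subgeometric_conv.
  assert (H0 : forall n, euler_coef (conv g e) n = RtoC 0).
  { apply psum_zero_coef; [now apply subgeometric_euler|].
    intros w Hw _.
    rewrite (psum_ext _ _ w (euler_conv g e)).
    rewrite psum_lin, !psum_conv, !psum_euler; try easy;
      try apply subgeometric_conv; try apply subgeometric_euler; try easy.
    unfold g, e; rewrite !psum_deriv_ode, Ec' by easy; ring. }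
  assert (E1 : psum (conv g e) z = RtoC 1).
  { apply psum_unique, is_series_decr_1.
    replace (plus _ _) with (RtoC 0).
    2: { unfold conv; rewrite sum_O.
         change (RtoC 0 = RtoC 1 + - (1 * 1 * 1))%C; ring. }
    eapply is_series_C_ext; [|exact is_series_C_0].
    intro n; specialize (H0 (S n)); unfold euler_coef in H0.
    destruct (Ceq_dec (conv g e (S n)) (RtoC 0)) as [E|E]; [rewrite E; ring|].
    exfalso; revert H0; apply Cmult_neq_0; [apply INR_S_neq_0|easy]. }
  intro E; rewrite psum_conv in E1 by easy.
  fold g in E; rewrite E, Cmult_0_l in E1; apply RtoC_inj in E1; lra.
Qed.

Definition times_z (g : nat -> C) (n : nat) : C :=
  match n with O => RtoC 0 | S n => g n end.

(** With c = (psi - 1)/z and G' = c G, the function f = z G satisfies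
    z f'/f = 1 + z c = psi. *)
Lemma exists_with_log_derivative (psi : C -> C) (b : nat -> C) :
  expansion_on_disk psi b -> b 0%nat = RtoC 1 ->
  exists (f : C -> C) (a : nat -> C),
    class_A f /\ (forall z, unit_disk z -> z <> RtoC 0 -> f z <> RtoC 0) /\
    (forall z, unit_disk z -> log_derivative f z = psi z) /\
    expansion_on_disk f a /\ a 2%nat = b 1%nat /\
    a 3%nat = ((b 2%nat + b 1%nat ^ 2) / 2)%C.
Proof.
  intros Hpsi Hb0.
  pose proof (expansion_subgeometric psi b Hpsi) as Hb.
  set (c := fun n => b (S n)).
  assert (Hc : subgeometric c) by now apply subgeometric_shift.
  set (g := ode_coef c); set (a := times_z g).
  assert (Hg : subgeometric g) by now apply ode_coef_subgeometric.
  assert (Ha : subgeometric a) by now apply subgeometric_decr.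
  assert (Hf : expansion_on_disk (psum a) a) by now apply psum_expansion.
  assert (Ef : forall z, unit_disk z -> psum a z = (z * psum g z)%C).
  { intros z Hz; rewrite psum_decr by easy.
    change (a 0%nat) with (RtoC 0); change (fun n => a (S n)) with g; ring. }
  assert (Edf : forall z, unit_disk z -> psum (deriv_coef a) z
                 = (psum g z * psi z)%C).
  { intros z Hz; rewrite (psum_ext _ (fun n => g n + 1 * euler_coef g n)%C).
    2: { intro n; unfold deriv_coef, euler_coef; change (a (S n)) with (g n).
         rewrite S_INR, RtoC_plus; ring. }
    rewrite psum_lin by (try apply subgeometric_euler; easy).
    rewrite psum_euler by easy; unfold g; rewrite psum_deriv_ode by easy.
    rewrite (expansion_psum psi b z Hpsi Hz), (psum_decr b z Hb Hz), Hb0.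
    fold c; ring. }
  assert (U0 : unit_disk (RtoC 0)) by (unfold unit_disk; rewrite Cmod_0; lra).
  assert (Eg0 : psum g (RtoC 0) = RtoC 1).
  { rewrite psum_decr by easy; change (g 0%nat) with (RtoC 1); ring. }
  assert (Epsi0 : psi (RtoC 0) = RtoC 1).
  { rewrite (expansion_psum psi b _ Hpsi U0), (psum_decr b _ Hb U0), Hb0; ring. }
  assert (Hnz : forall z, unit_disk z -> z <> RtoC 0 -> psum a z <> RtoC 0).
  { intros z Hz Hz0; rewrite Ef by easy.
    apply Cmult_neq_0; [easy|]; now apply psum_ode_neq_0. }
  exists (psum a), a.
  split; [split; [|split]|split; [|split; [|split; [|split]]]].
  - exact (expansion_analytic _ _ Hf).
  - rewrite Ef by easy; ring.
  - pose proof (is_derive_expansion _ a (RtoC 0) Hf U0) as H.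
    rewrite Edf, Eg0, Epsi0, Cmult_1_l in H by easy; exact H.
  - exact Hnz.
  - intros z Hz; unfold log_derivative; destruct (Ceq_dec z (RtoC 0)) as [->|Hz0].
    + now symmetry.
    + rewrite (is_C_derive_unique _ _ _ (is_derive_expansion _ a z Hf Hz)).
      rewrite Edf, Ef by easy; field.
      split; [now apply psum_ode_neq_0|exact Hz0].
  - exact Hf.
  - pose proof (ode_coef_spec c 0) as H; unfold deriv_coef, conv in H.
    rewrite sum_O in H; fold g in H; change (g 0%nat) with (RtoC 1) in H.
    change (a 2%nat) with (g 1%nat); change (b 1%nat) with (c (0 - 0)%nat).
    change (INR 1) with 1 in H; rewrite !Cmult_1_l in H; exact H.
  - pose proof (ode_coef_spec c 0) as H1; pose proof (ode_coef_spec c 1) as H.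
    unfold deriv_coef, conv in H, H1; fold g in H, H1.
    rewrite sum_Sn, sum_O in H; rewrite sum_O in H1.
    change (g 0%nat) with (RtoC 1) in H, H1; change (INR 1) with 1 in H1.
    change (INR 2) with 2 in H; simpl minus in H, H1.
    change (c 0%nat) with (b 1%nat) in *; change (c 1%nat) with (b 2%nat) in *.
    rewrite !Cmult_1_l in H1; rewrite H1 in H.
    change (2 * g 2%nat = 1 * b 2%nat + b 1%nat * b 1%nat)%C in H.
    change (a 3%nat) with (g 2%nat).
    assert (N2 : RtoC 2 <> RtoC 0) by (intro E; apply RtoC_inj in E; lra).
    replace (b 2%nat + b 1%nat ^ 2)%C with (2 * g 2%nat)%C by (rewrite H; ring).
    field; easy.
Qed.

(** * Finite Taylor expansions with bounded remainder *)

Definition bounded_near (g : C -> C) (z0 : C) : Prop :=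
  exists d M, 0 < d /\ forall z, Cmod (z - z0) < d -> Cmod (g z) <= M.

(** A Taylor polynomial of degree n - 1 at z0 together with a bounded
    remainder, in nested form.  This is all that the local arguments need of
    analyticity, and it passes to products and quotients by algebra alone.
    The factorization is required at every z, not only near z0: away from z0 it
    can always be solved for g1. *)
Fixpoint jet (n : nat) (g : C -> C) (z0 : C) : Prop :=
  match n with
  | O => bounded_near g z0
  | S m => exists (c : C) (g1 : C -> C),
      jet m g1 z0 /\ forall z, g z = (c + (z - z0) * g1 z)%C
  end.

Lemma Cminus_diag (z : C) : (z - z)%C = RtoC 0.
Proof. ring. Qed.

Lemma jet_S_le (n : nat) (g : C -> C) (z0 : C) : jet (S n) g z0 -> jet n g z0.
Proof.
  revert g; induction n as [|n IH]; intros g (c & g1 & H1 & E).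
  - destruct H1 as (d & M & Hd & HM).
    exists d, (Cmod c + d * M); split; [easy|]; intros z Hz; rewrite E.
    eapply Rle_trans; [apply Cmod_triangle|]; rewrite Cmod_mult.
    specialize (HM z Hz); pose proof (Cmod_ge_0 (g1 z)); pose proof (Cmod_ge_0 (z - z0)).
    nra.
  - exists c, g1; split; [now apply IH|exact E].
Qed.

Lemma jet_le (m n : nat) (g : C -> C) (z0 : C) :
  (m <= n)%nat -> jet n g z0 -> jet m g z0.
Proof. induction 1; [easy|]; intro H'; now apply IHle, jet_S_le. Qed.

Lemma jet_bounded_near (n : nat) (g : C -> C) (z0 : C) : jet n g z0 -> bounded_near g z0.
Proof. exact (jet_le 0 n g z0 ltac:(lia)). Qed.

(** Only the values near z0 matter: away from z0 the factorization defines the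
    next function in the tower, and at z0 the old one is kept. *)
Lemma jet_local (n : nat) (f g : C -> C) (z0 : C) (d : R) :
  0 < d -> (forall z, Cmod (z - z0) < d -> f z = g z) -> jet n f z0 -> jet n g z0.
Proof.
  revert f g; induction n as [|n IH]; intros f g Hd Hfg.
  - intros (d' & M & Hd' & HM); exists (Rmin d d'), M; split; [now apply Rmin_pos|].
    intros z Hz; rewrite <- Hfg by (eapply Rlt_le_trans; [exact Hz|apply Rmin_l]).
    apply HM; eapply Rlt_le_trans; [exact Hz|apply Rmin_r].
  - intros (c & f1 & H1 & E).
    assert (Ec : g z0 = c).
    { rewrite <- Hfg, E by (rewrite Cminus_diag, Cmod_0; easy); ring. }
    assert (Hsub : forall z, z <> z0 -> (z - z0)%C <> RtoC 0).
    { intros z Hz H0; apply Hz; replace z with ((z - z0) + z0)%C by ring.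
      rewrite H0; ring. }
    exists c, (fun z => if Ceq_dec z z0 then f1 z0 else (g z - c) / (z - z0))%C; split.
    + apply (IH f1); [easy| |easy].
      intros z Hz; destruct (Ceq_dec z z0) as [->|Hz0]; [easy|].
      rewrite <- (Hfg z Hz), E; field; now apply Hsub.
    + intro z; destruct (Ceq_dec z z0) as [->|Hz0]; [rewrite Ec; ring|].
      field; now apply Hsub.
Qed.

Lemma bounded_near_const (c z0 : C) : bounded_near (fun _ => c) z0.
Proof. exists 1, (Cmod c); split; [lra|intros; lra]. Qed.

Lemma jet_const (n : nat) (c z0 : C) : jet n (fun _ => c) z0.
Proof.
  revert c; induction n as [|n IH]; intro c; [apply bounded_near_const|].
  exists c, (fun _ => RtoC 0); split; [apply IH|intro; ring].
Qed.

Lemma jet_id (n : nat) (z0 : C) : jet n (fun z => z) z0.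
Proof.
  apply (jet_le n (S n)); [lia|].
  exists z0, (fun _ => RtoC 1); split; [apply jet_const|intro; ring].
Qed.

Lemma bounded_near_plus (f g : C -> C) (z0 : C) :
  bounded_near f z0 -> bounded_near g z0 -> bounded_near (fun z => f z + g z)%C z0.
Proof.
  intros (d & M & Hd & HM) (e & N & He & HN).
  exists (Rmin d e), (M + N); split; [now apply Rmin_pos|]; intros z Hz.
  eapply Rle_trans; [apply Cmod_triangle|apply Rplus_le_compat].
  - apply HM; eapply Rlt_le_trans; [exact Hz|apply Rmin_l].
  - apply HN; eapply Rlt_le_trans; [exact Hz|apply Rmin_r].
Qed.

Lemma bounded_near_mult (f g : C -> C) (z0 : C) :
  bounded_near f z0 -> bounded_near g z0 -> bounded_near (fun z => f z * g z)%C z0.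
Proof.
  intros (d & M & Hd & HM) (e & N & He & HN).
  exists (Rmin d e), (M * N); split; [now apply Rmin_pos|]; intros z Hz.
  rewrite Cmod_mult; apply Rmult_le_compat; try apply Cmod_ge_0.
  - apply HM; eapply Rlt_le_trans; [exact Hz|apply Rmin_l].
  - apply HN; eapply Rlt_le_trans; [exact Hz|apply Rmin_r].
Qed.

Lemma jet_plus (n : nat) (f g : C -> C) (z0 : C) :
  jet n f z0 -> jet n g z0 -> jet n (fun z => f z + g z)%C z0.
Proof.
  revert f g; induction n as [|n IH]; intros f g; [apply bounded_near_plus|].
  intros (c & f1 & Hf & Ef) (e & g1 & Hg & Eg).
  exists (c + e)%C, (fun z => f1 z + g1 z)%C; split; [now apply IH|].
  intro z; rewrite Ef, Eg; ring.
Qed.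

Lemma jet_mult (n : nat) (f g : C -> C) (z0 : C) :
  jet n f z0 -> jet n g z0 -> jet n (fun z => f z * g z)%C z0.
Proof.
  revert f g; induction n as [|n IH]; intros f g; [apply bounded_near_mult|].
  intros (c & f1 & Hf & Ef) (e & g1 & Hg & Eg).
  exists (c * e)%C,
    (fun z => (c * g1 z + e * f1 z) + (z + - z0) * (f1 z * g1 z))%C; split.
  - apply jet_plus; [apply jet_plus; apply IH; easy || apply jet_const|].
    apply IH; [apply jet_plus; [apply jet_id|apply jet_const]|now apply IH].
  - intro z; rewrite Ef, Eg; ring.
Qed.

Lemma jet_lower_bound (n : nat) (f : C -> C) (z0 : C) :
  jet (S n) f z0 -> f z0 <> RtoC 0 ->
  exists d m, 0 < d /\ 0 < m /\ forall z, Cmod (z - z0) < d -> m <= Cmod (f z).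
Proof.
  intros (c & f1 & Hf1 & E) H0.
  apply jet_bounded_near in Hf1; destruct Hf1 as (d & M & Hd & HM).
  assert (Ec : f z0 = c) by (rewrite E; ring).
  assert (Hc : 0 < Cmod c) by (apply Cmod_gt_0; congruence).
  pose proof (Rabs_pos M); pose proof (Rle_abs M).
  exists (Rmin d (Cmod c / (2 * (Rabs M + 1)))), (Cmod c / 2).
  split; [|split; [lra|]].
  { apply Rmin_pos; [easy|apply Rdiv_lt_0_compat; lra]. }
  intros z Hz.
  assert (Hz1 : Cmod (z - z0) < d) by (eapply Rlt_le_trans; [exact Hz|apply Rmin_l]).
  assert (Hz2 : Cmod (z - z0) < Cmod c / (2 * (Rabs M + 1)))
    by (eapply Rlt_le_trans; [exact Hz|apply Rmin_r]).
  specialize (HM z Hz1).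
  apply (Rlt_div_r _ _ _ (ltac:(lra) : 2 * (Rabs M + 1) > 0)) in Hz2.
  pose proof (Cmod_triangle (f z) (- ((z - z0) * f1 z))) as HT.
  replace (f z + - ((z - z0) * f1 z))%C with c in HT by (rewrite E; ring).
  rewrite Cmod_opp, Cmod_mult in HT.
  pose proof (Cmod_ge_0 (z - z0)); pose proof (Cmod_ge_0 (f1 z)); nra.
Qed.

(** 1/f = 1/c - (z - z0) (f1 / c) (1/f) near z0, so each jet of 1/f yields the
    next one. *)
Lemma jet_inv (n : nat) (f : C -> C) (z0 : C) :
  jet (S n) f z0 -> f z0 <> RtoC 0 -> jet (S n) (fun z => / f z)%C z0.
Proof.
  intros Hf H0.
  destruct (jet_lower_bound n f z0 Hf H0) as (d & m & Hd & Hm & Hlow).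
  assert (Hnz : forall z, Cmod (z - z0) < d -> f z <> RtoC 0).
  { intros z Hz; apply Cmod_gt_0; specialize (Hlow z Hz); lra. }
  assert (H : forall k, (k <= S n)%nat -> jet k (fun z => / f z)%C z0).
  { induction k as [|k IH]; intro Hk.
    - exists d, (/ m); split; [easy|]; intros z Hz.
      rewrite Cmod_inv by now apply Hnz.
      apply Rinv_le_contravar; [easy|now apply Hlow].
    - destruct (jet_le (S k) (S n) f z0 Hk Hf) as (c & f1 & Hf1 & E).
      assert (Ec : f z0 = c) by (rewrite E; ring).
      assert (Hc : c <> RtoC 0) by congruence.
      apply (jet_local _ (fun z => / c + (z - z0) * ((- / c) * f1 z * / f z))%C _ z0 d Hd).
      + intros z Hz; specialize (Hnz z Hz).
        transitivity ((f z - (z - z0) * f1 z) * / (c * f z))%C; [field; easy|].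
        rewrite E at 1; rewrite E in Hnz; rewrite E; field; easy.
      + exists (/ c)%C, (fun z => (- / c) * f1 z * / f z)%C; split; [|easy].
        apply jet_mult; [apply jet_mult; [apply jet_const|easy]|apply IH; lia]. }
  apply H; lia.
Qed.

Lemma psum_jet (r M : R) (c : nat -> C) (z0 : C) (n : nat) :
  0 < r -> geometric r M c -> jet n (fun z => psum c (z - z0)) z0.
Proof.
  intro Hr; revert c M; induction n as [|n IH]; intros c M Hc.
  - exists (r / 2), (M * 2); split; [lra|]; intros z Hz.
    eapply Rle_trans; [apply (Cmod_psum_le r M); easy || lra|].
    assert (HM0 : 0 <= M).
    { eapply Rle_trans; [|apply (Hc 0%nat)].
      apply Rmult_le_pos; [apply Cmod_ge_0|apply pow_le; lra]. }
    apply Rmult_le_compat_l; [easy|]; apply Rle_div_l; lra.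
  - apply (jet_local _ (fun z => c 0%nat + (z - z0) * psum (fun n => c (S n)) (z - z0))%C
             _ z0 r Hr).
    + intros z Hz; symmetry; now apply (psum_shift r M).
    + exists (c 0%nat), (fun z => psum (fun n => c (S n)) (z - z0)); split; [|easy].
      apply (IH _ (M / r ^ 1)); exact (geometric_shift r M c 1 Hr Hc).
Qed.

Lemma analytic_jet (n : nat) (f : C -> C) (z0 : C) : analytic_at f z0 -> jet n f z0.
Proof.
  intros (c & r & Hr & H).
  assert (Hc : exists M, geometric (r / 2) M c).
  { assert (Hm : Cmod (z0 + RtoC (r / 2) - z0) = r / 2).
    { replace (z0 + RtoC (r / 2) - z0)%C with (RtoC (r / 2)) by ring.
      rewrite Cmod_R, Rabs_pos_eq; lra. }
    specialize (H (z0 + RtoC (r / 2))%C ltac:(lra)).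
    apply is_pseries_C, is_series_bounded in H; destruct H as [M HM].
    exists M; intro k; specialize (HM k).
    now rewrite Cmod_mult, Cmod_pow, Hm in HM. }
  destruct Hc as [M HM].
  apply (jet_local n (fun z => psum c (z - z0)) f z0 r Hr).
  - intros z Hz; now apply psum_unique, is_pseries_C, H.
  - apply (psum_jet (r / 2) M); [lra|easy].
Qed.

(** * The maximum principle and the Schwarz lemma *)

Definition square (z : C) : Prop := -1 <= Re z <= 1 /\ -1 <= Im z <= 1.

(** In Q d z the number d serves both as the size of a neighbourhood and as the
    margin in the conclusion, so that a uniform lower bound for the sizes is
    also a uniform margin. *)
Lemma square_compact (Q : R -> C -> Prop) :
  (forall d d' z, 0 < d' <= d -> Q d z -> Q d' z) ->
  (forall z0, exists d, 0 < d /\ forall z, Cmod (z - z0) < d -> Q d z) ->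
  exists d, 0 < d /\ forall z, square z -> Q d z.
Proof.
  intros Hmon Hloc.
  assert (Hd : forall z0, {d : posreal | forall z,
     Rabs (Re z - Re z0) < d -> Rabs (Im z - Im z0) < d -> Q d z}).
  { intro z0; apply constructive_indefinite_description.
    destruct (Hloc z0) as (d & Hd & H).
    assert (Hd2 : 0 < d / 2) by lra.
    exists (mkposreal _ Hd2); simpl; intros z H1 H2.
    apply (Hmon d); [lra|]; apply H.
    eapply Rle_lt_trans; [apply Cmod_2Rmax|].
    assert (Hs : sqrt 2 < 2).
    { rewrite <- (sqrt_Rsqr 2) at 2 by lra; apply sqrt_lt_1; unfold Rsqr; lra. }
    pose proof (sqrt_pos 2).
    assert (Hm : Rmax (Rabs (fst (z - z0)%C)) (Rabs (snd (z - z0)%C)) < d / 2)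
      by (apply Rmax_lub_lt; easy).
    assert (0 <= Rmax (Rabs (fst (z - z0)%C)) (Rabs (snd (z - z0)%C)))
      by (eapply Rle_trans; [apply Rabs_pos|apply Rmax_l]).
    nra. }
  destruct (compactness_value_2d (-1) 1 (-1) 1 (fun x y => proj1_sig (Hd (x, y))))
    as [d H].
  exists d; split; [apply cond_pos|]; intros z [Hz1 Hz2].
  specialize (H (Re z) (Im z) Hz1 Hz2); apply NNPP in H.
  destruct H as (u & v & _ & _ & Hu & Hv & Hle).
  destruct (Hd (u, v)) as [d' Hd']; simpl in *.
  apply (Hmon d'); [split; [apply cond_pos|easy]|].
  now apply Hd'.
Qed.

(** An upper semicontinuous function is bounded on the square, by compactness
    with margin 1/d.  If its supremum S there were never reached, compactness
    with margin d below S would give the smaller upper bound S - d. *)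
Lemma usc_dominated_on_square (U : C -> R) :
  (forall z0 e, 0 < e -> exists d, 0 < d /\ forall z, Cmod (z - z0) < d -> U z < U z0 + e) ->
  exists zm, forall z, square z -> U z <= U zm.
Proof.
  intro Husc.
  destruct (square_compact (fun d z => U z <= / d)) as (b & Hb & HB).
  { intros d d' z Hd H; eapply Rle_trans; [exact H|].
    apply Rinv_le_contravar; lra. }
  { intro z0; destruct (Husc z0 1 Rlt_0_1) as (d & Hd & H).
    pose proof (Rabs_pos (U z0)); pose proof (Rle_abs (U z0)).
    assert (Hi : 0 < / (Rabs (U z0) + 1)) by (apply Rinv_0_lt_compat; lra).
    exists (Rmin d (/ (Rabs (U z0) + 1))); split; [now apply Rmin_pos|].
    intros z Hz; apply Rle_trans with (Rabs (U z0) + 1).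
    - assert (Hz' : Cmod (z - z0) < d) by (eapply Rlt_le_trans; [exact Hz|apply Rmin_l]).
      specialize (H z Hz'); lra.
    - rewrite <- (Rinv_inv (Rabs (U z0) + 1)) at 1; apply Rinv_le_contravar.
      + now apply Rmin_pos.
      + apply Rmin_r. }
  destruct (completeness (fun x => exists z, square z /\ x = U z)) as [S [Hub Hlub]].
  { exists (/ b); intros x (z & Hz & ->); now apply HB. }
  { exists (U (RtoC 0)), (RtoC 0); split; [split; simpl; lra|easy]. }
  destruct (classic (exists zm, S <= U zm)) as [[zm Hm]|Hno].
  { exists zm; intros z Hz; eapply Rle_trans; [|exact Hm]; apply Hub; now exists z. }
  exfalso.
  destruct (square_compact (fun d z => U z <= S - d)) as (d & Hd & HD).
  { intros d d' z Hd H; lra. }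
  { intro z0; assert (Hz0 : U z0 < S).
    { apply Rnot_le_lt; intro H; apply Hno; now exists z0. }
    destruct (Husc z0 ((S - U z0) / 2) ltac:(lra)) as (d & Hd & H).
    exists (Rmin d ((S - U z0) / 2)); split; [apply Rmin_pos; lra|].
    intros z Hz.
    assert (Hz' : Cmod (z - z0) < d) by (eapply Rlt_le_trans; [exact Hz|apply Rmin_l]).
    specialize (H z Hz'); pose proof (Rmin_r d ((S - U z0) / 2)); lra. }
  assert (S <= S - d); [|lra].
  apply Hlub; intros x (z & Hz & ->); now apply HD.
Qed.

Lemma Cmod_sq_usc (n : nat) (g : C -> C) (z0 : C) (e : R) :
  jet (S n) g z0 -> 0 < e ->
  exists d, 0 < d /\ forall z, Cmod (z - z0) < d -> Cmod (g z) ^ 2 < Cmod (g z0) ^ 2 + e.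
Proof.
  intros (c & g1 & H1 & E) He; apply jet_bounded_near in H1.
  destruct H1 as (d & M & Hd & HM).
  assert (Ec : g z0 = c) by (rewrite E; ring).
  pose proof (Rabs_pos M); pose proof (Rle_abs M); pose proof (Cmod_ge_0 c).
  (* If |g z| < |c| + k with k <= 1, then |g z|^2 < |c|^2 + k (2 |c| + 1). *)
  set (k := Rmin 1 (e / (2 * Cmod c + 2))).
  assert (Hk : 0 < k) by (apply Rmin_pos; [lra|apply Rdiv_lt_0_compat; lra]).
  assert (Hk1 : k <= 1) by apply Rmin_l.
  assert (Hk2 : k <= e / (2 * Cmod c + 2)) by apply Rmin_r.
  apply (Rle_div_r _ _ _ (ltac:(lra) : 2 * Cmod c + 2 > 0)) in Hk2.
  exists (Rmin d (k / (Rabs M + 1))); split.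
  { apply Rmin_pos; [easy|apply Rdiv_lt_0_compat; lra]. }
  intros z Hz.
  assert (Hz1 : Cmod (z - z0) < d) by (eapply Rlt_le_trans; [exact Hz|apply Rmin_l]).
  assert (Hz2 : Cmod (z - z0) < k / (Rabs M + 1))
    by (eapply Rlt_le_trans; [exact Hz|apply Rmin_r]).
  apply (Rlt_div_r _ _ _ (ltac:(lra) : Rabs M + 1 > 0)) in Hz2.
  specialize (HM z Hz1); rewrite Ec, E.
  pose proof (Cmod_triangle c ((z - z0) * g1 z)) as HT; rewrite Cmod_mult in HT.
  pose proof (Cmod_ge_0 (z - z0)); pose proof (Cmod_ge_0 (g1 z)).
  pose proof (Cmod_ge_0 (c + (z - z0) * g1 z)).
  assert (Cmod (c + (z - z0) * g1 z) < Cmod c + k) by nra.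
  nra.
Qed.

(** The mixed terms cancel because the sums of h, of h^2 and of h^2 times the
    conjugate of h vanish when h runs through s times the fourth roots of 1. *)
Lemma four_point_quadratic (a b c : C) (s : R) :
  Cmod (a + s * (b + s * c)) ^ 2 + Cmod (a + - s * (b + - s * c)) ^ 2
  + Cmod (a + Ci * s * (b + Ci * s * c)) ^ 2
  + Cmod (a + - (Ci * s) * (b + - (Ci * s) * c)) ^ 2
  = 4 * (Cmod a ^ 2 + Cmod b ^ 2 * s ^ 2 + Cmod c ^ 2 * s ^ 4).
Proof.
  rewrite !Cmod2_alt; destruct a as [a1 a2], b as [b1 b2], c as [c1 c2].
  unfold Re, Im; simpl; ring.
Qed.

Lemma Cmod_sq_perturb (p e : C) (P K : R) :
  Cmod p <= P -> Cmod e <= K -> Cmod p ^ 2 - 2 * P * K <= Cmod (p + e) ^ 2.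
Proof.
  intros Hp He.
  pose proof (Cmod_ge_0 p); pose proof (Cmod_ge_0 e); pose proof (Cmod_ge_0 (p + e)).
  pose proof (Cmod_triangle (p + e) (- e)) as HT; rewrite Cmod_opp in HT.
  replace (p + e + - e)%C with p in HT by ring.
  assert (Hsq : Cmod p ^ 2 - 2 * Cmod p * Cmod e <= Cmod (p + e) ^ 2).
  { destruct (Rle_or_lt (Cmod e) (Cmod p)); nra. }
  assert (Cmod p * Cmod e <= P * K) by (apply Rmult_le_compat; easy).
  lra.
Qed.

(** A discrete form of the fact that the Laplacian of |g|^2 is 4 |g'|^2 >= 0:
    the mean of |g|^2 over the four points is at least |g(z0)|^2 up to O(s^3),
    while that of eps |z|^2 exceeds its value at z0 by eps s^2. *)
Lemma no_local_max (g : C -> C) (z0 : C) (eps d0 : R) :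
  jet 3 g z0 -> 0 < eps -> 0 < d0 ->
  exists z, Cmod (z - z0) < d0 /\
    Cmod (g z0) ^ 2 + eps * Cmod z0 ^ 2 < Cmod (g z) ^ 2 + eps * Cmod z ^ 2.
Proof.
  intros (a & g1 & (b & g2 & (c & w & (d & M & Hd & HM) & E3) & E2) & E1) Heps Hd0.
  assert (E : forall h, g (z0 + h)%C = (a + h * (b + h * c) + h ^ 3 * w (z0 + h))%C).
  { intro h; rewrite E1, E2, E3; ring. }
  assert (Ea : g z0 = a) by (rewrite E1; ring).
  set (P := Cmod a + Cmod b + Cmod c).
  pose proof (Cmod_ge_0 a); pose proof (Cmod_ge_0 b); pose proof (Cmod_ge_0 c).
  pose proof (Rabs_pos M); pose proof (Rle_abs M).
  (* P bounds the quadratic part for s <= 1 and M s^3 the remainder, so that s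
     must be small compared to eps / (P M). *)
  set (T := P * Rabs M + 1).
  assert (HT : 0 < T) by (unfold T, P; nra).
  set (s := Rmin (Rmin (d / 2) (d0 / 2)) (Rmin 1 (eps / (2 * T)))).
  assert (Hs : 0 < s).
  { repeat apply Rmin_pos; try lra; apply Rdiv_lt_0_compat; lra. }
  assert (Hs1 : s <= d / 2) by (eapply Rle_trans; [apply Rmin_l|apply Rmin_l]).
  assert (Hs2 : s <= d0 / 2) by (eapply Rle_trans; [apply Rmin_l|apply Rmin_r]).
  assert (Hs3 : s <= 1) by (eapply Rle_trans; [apply Rmin_r|apply Rmin_l]).
  assert (Hs4 : s <= eps / (2 * T)) by (eapply Rle_trans; [apply Rmin_r|apply Rmin_r]).
  apply (Rle_div_r _ _ _ (ltac:(lra) : 2 * T > 0)) in Hs4.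
  assert (Hpt : forall h, Cmod h = s ->
     Cmod (a + h * (b + h * c)) ^ 2 - 2 * P * (Rabs M * s ^ 3) <= Cmod (g (z0 + h)%C) ^ 2).
  { intros h Hh; rewrite E; apply Cmod_sq_perturb.
    - unfold P; eapply Rle_trans; [apply Cmod_triangle|].
      rewrite Cmod_mult, Hh.
      pose proof (Cmod_triangle b (h * c)) as Ht; rewrite Cmod_mult, Hh in Ht.
      pose proof (Cmod_ge_0 (b + h * c)); nra.
    - rewrite Cmod_mult, Cmod_pow, Hh, Rmult_comm.
      apply Rmult_le_compat_r; [apply pow_le; lra|].
      eapply Rle_trans; [apply HM|easy].
      replace (z0 + h - z0)%C with h by ring; lra. }
  apply NNPP; intro Hno.
  assert (Hall : forall h, Cmod h = s ->
    Cmod (g (z0 + h)%C) ^ 2 + eps * Cmod (z0 + h) ^ 2 <= Cmod a ^ 2 + eps * Cmod z0 ^ 2).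
  { intros h Hh; apply Rnot_lt_le; intro Hlt; apply Hno; exists (z0 + h)%C.
    rewrite Ea; replace (z0 + h - z0)%C with h by ring; split; [lra|easy]. }
  assert (N1 : Cmod s = s) by (rewrite Cmod_R, Rabs_pos_eq; lra).
  assert (N2 : Cmod (- s) = s) by now rewrite Cmod_opp.
  assert (N3 : Cmod (Ci * s) = s) by (rewrite Cmod_mult, Cmod_Ci, N1; ring).
  assert (N4 : Cmod (- (Ci * s)) = s) by now rewrite Cmod_opp.
  pose proof (four_point_quadratic a b c s) as F.
  pose proof (four_point_quadratic z0 1 0 s) as G.
  rewrite Cmod_1, Cmod_0 in G.
  replace (z0 + s * (1 + s * 0))%C with (z0 + s)%C in G by ring.
  replace (z0 + - s * (1 + - s * 0))%C with (z0 + - s)%C in G by ring.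
  replace (z0 + Ci * s * (1 + Ci * s * 0))%C with (z0 + Ci * s)%C in G by ring.
  replace (z0 + - (Ci * s) * (1 + - (Ci * s) * 0))%C with (z0 + - (Ci * s))%C in G by ring.
  pose proof (Hpt _ N1); pose proof (Hpt _ N2).
  pose proof (Hpt _ N3); pose proof (Hpt _ N4).
  pose proof (Hall _ N1); pose proof (Hall _ N2).
  pose proof (Hall _ N3); pose proof (Hall _ N4).
  assert (0 <= Cmod b ^ 2 * s ^ 2) by (apply Rmult_le_pos; apply pow_le; lra).
  assert (0 <= Cmod c ^ 2 * s ^ 4) by (apply Rmult_le_pos; apply pow_le; lra).
  assert (K : eps * s ^ 2 <= 2 * P * (Rabs M * s ^ 3)).
  { assert (G' := f_equal (Rmult eps) G). nra. }
  assert (s ^ 2 > 0) by (apply pow_lt; easy).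
  assert (eps * s ^ 2 <= 2 * (P * Rabs M) * s * s ^ 2) by (simpl in *; lra).
  assert (eps <= 2 * (P * Rabs M) * s) by nra.
  unfold T in Hs4; nra.
Qed.

(** Perturbing |g|^2 by eps |z|^2 rules out interior maxima, so the maximum
    over the closed disk is on the circle; as r < 1, a value of |g| above K
    leaves room for such an eps. *)
Lemma max_modulus (g : C -> C) (r K : R) :
  0 < r < 1 -> 0 <= K ->
  (forall z, unit_disk z -> jet 3 g z) ->
  (forall z, Cmod z = r -> Cmod (g z) <= K) ->
  forall z, Cmod z <= r -> Cmod (g z) <= K.
Proof.
  intros Hr HK Hjet Hbd z1 Hz1; apply Rnot_lt_le; intro Hgt.
  set (eps := (Cmod (g z1) ^ 2 - K ^ 2) / 2).
  assert (Heps : 0 < eps) by (unfold eps; nra).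
  set (u := fun z => Cmod (g z) ^ 2 + eps * Cmod z ^ 2).
  (* Extended by its least possible value, u stays upper semicontinuous and a
     dominating point can only lie in the disk. *)
  set (U := fun z => if Rle_dec (Cmod z) r then u z else 0).
  assert (Hu0 : forall z, 0 <= u z).
  { intro z; unfold u; pose proof (pow2_ge_0 (Cmod (g z))).
    pose proof (pow2_ge_0 (Cmod z)); nra. }
  destruct (usc_dominated_on_square U) as [zm Hm].
  { intros z0 e He; unfold U at 2; destruct (Rle_dec (Cmod z0) r) as [Hin|Hout].
    - assert (Hz0 : unit_disk z0) by (unfold unit_disk; lra).
      destruct (Cmod_sq_usc 2 g z0 (e / 2) (Hjet z0 Hz0) ltac:(lra)) as (d1 & Hd1 & H1).
      destruct (Cmod_sq_usc 2 (fun z => z) z0 (e / (2 * eps)) (jet_id 3 z0))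
        as (d2 & Hd2 & H2).
      { apply Rdiv_lt_0_compat; lra. }
      exists (Rmin d1 d2); split; [now apply Rmin_pos|]; intros z Hz.
      unfold U; destruct (Rle_dec (Cmod z) r); [|specialize (Hu0 z0); lra].
      specialize (H1 z (Rlt_le_trans _ _ _ Hz (Rmin_l _ _))).
      specialize (H2 z (Rlt_le_trans _ _ _ Hz (Rmin_r _ _))).
      apply (Rmult_lt_compat_l eps) in H2; [|easy].
      replace (eps * (Cmod z0 ^ 2 + e / (2 * eps))) with (eps * Cmod z0 ^ 2 + e / 2) in H2
        by (field; lra).
      unfold u; lra.
    - exists (Cmod z0 - r); split; [lra|]; intros z Hz; unfold U.
      destruct (Rle_dec (Cmod z) r); [exfalso|lra].
      pose proof (Cmod_triangle z (- (z - z0))) as HT; rewrite Cmod_opp in HT.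
      replace (z + - (z - z0))%C with z0 in HT by ring; lra. }
  assert (Hsq : forall z, Cmod z <= r -> square z).
  { intros z Hz; pose proof (Rmax_Cmod z) as Hx.
    pose proof (Rmax_l (Rabs (fst z)) (Rabs (snd z))).
    pose proof (Rmax_r (Rabs (fst z)) (Rabs (snd z))).
    split; apply Rabs_le_between; unfold Re, Im; lra. }
  assert (HU : forall z, Cmod z <= r -> U z = u z).
  { intros z Hz; unfold U; destruct (Rle_dec (Cmod z) r); easy. }
  assert (Hlow : K ^ 2 + eps < u z1).
  { unfold u; pose proof (pow2_ge_0 (Cmod z1)).
    replace (Cmod (g z1) ^ 2) with (K ^ 2 + 2 * eps) by (unfold eps; field); nra. }
  pose proof (Hm z1 (Hsq z1 Hz1)) as Hm1; rewrite (HU z1 Hz1) in Hm1.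
  assert (Hzm : Cmod zm <= r).
  { unfold U in Hm1; destruct (Rle_dec (Cmod zm) r); [easy|].
    pose proof (pow2_ge_0 K); lra. }
  rewrite (HU zm Hzm) in Hm1.
  destruct (Req_dec (Cmod zm) r) as [Heq|Hne].
  - specialize (Hbd zm Heq); unfold u at 2 in Hm1; rewrite Heq in Hm1.
    pose proof (Cmod_ge_0 (g zm)).
    assert (Cmod (g zm) ^ 2 <= K ^ 2) by nra.
    assert (r ^ 2 <= 1) by nra. nra.
  - destruct (no_local_max g zm eps (r - Cmod zm)) as (z & Hz & Hlt).
    + apply Hjet; unfold unit_disk; lra.
    + easy.
    + lra.
    + assert (Hzr : Cmod z <= r).
      { replace z with (zm + (z - zm))%C by ring.
        eapply Rle_trans; [apply Cmod_triangle|lra]. }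
      specialize (Hm z (Hsq z Hzr)); rewrite (HU z Hzr), (HU zm Hzm) in Hm.
      unfold u in Hm; lra.
Qed.

(** The quotient q is the remainder in the jet of h at 0, and so has the right
    value there; this is why h needs one order more than q.  On the circle of
    radius r, |q| <= 1/r, and r may be taken arbitrarily close to 1. *)
Lemma schwarz (n : nat) (h : C -> C) :
  (3 <= n)%nat ->
  (forall z, unit_disk z -> jet (S n) h z) ->
  (forall z, unit_disk z -> Cmod (h z) <= 1) ->
  h (RtoC 0) = RtoC 0 ->
  exists q : C -> C,
    (forall z, unit_disk z -> jet n q z) /\
    (forall z, h z = z * q z)%C /\
    (forall z, unit_disk z -> Cmod (q z) <= 1).
Proof.
  intros Hn Hjet Hle H0.
  assert (U0 : unit_disk (RtoC 0)) by (unfold unit_disk; rewrite Cmod_0; lra).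
  destruct (Hjet _ U0) as (c & q & Hq & E).
  assert (Ec : c = RtoC 0) by (rewrite E in H0; rewrite <- H0; ring).
  assert (Eq : forall z, h z = (z * q z)%C) by (intro z; rewrite E, Ec; ring).
  assert (Hqj : forall z, unit_disk z -> jet n q z).
  { intros z Hz; destruct (Ceq_dec z (RtoC 0)) as [->|Hz0]; [easy|].
    apply (jet_local n (fun w => h w * / w)%C q z (Cmod z)); [now apply Cmod_gt_0| |].
    - intros w Hw; rewrite Eq; field.
      intro Hw0; rewrite Hw0 in Hw; unfold Cminus in Hw.
      rewrite Cplus_0_l, Cmod_opp in Hw; lra.
    - apply jet_S_le, jet_mult; [now apply Hjet|].
      apply jet_inv; [apply jet_id|easy]. }
  exists q; split; [easy|]; split; [easy|].
  intros z Hz; apply Rnot_lt_le; intro Hgt.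
  unfold unit_disk in Hz; pose proof (Cmod_ge_0 z).
  set (r := Rmax ((1 + Cmod z) / 2) ((1 + / Cmod (q z)) / 2)).
  assert (Hi : / Cmod (q z) < 1) by (rewrite <- Rinv_1; apply Rinv_lt_contravar; lra).
  assert (Hi0 : 0 < / Cmod (q z)) by (apply Rinv_0_lt_compat; lra).
  assert (Hr1 : (1 + Cmod z) / 2 <= r) by apply Rmax_l.
  assert (Hr2 : (1 + / Cmod (q z)) / 2 <= r) by apply Rmax_r.
  assert (Hr3 : r < 1) by (apply Rmax_lub_lt; lra).
  assert (Hqz : Cmod (q z) <= / r).
  { apply (max_modulus q r); [lra|apply Rlt_le, Rinv_0_lt_compat; lra| | |lra].
    - intros w Hw; apply (jet_le 3 n); [easy|now apply Hqj].
    - intros w Hw; assert (Hwd : unit_disk w) by (unfold unit_disk; lra).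
      specialize (Hle w Hwd); rewrite Eq, Cmod_mult, Hw in Hle.
      apply (Rmult_le_reg_l r); [lra|]; rewrite Rinv_r by lra; easy. }
  apply (Rmult_le_compat_r r) in Hqz; [|lra]; rewrite Rinv_l in Hqz by lra.
  apply (Rmult_le_compat_l (Cmod (q z))) in Hr2; [|lra].
  replace (Cmod (q z) * ((1 + / Cmod (q z)) / 2)) with ((Cmod (q z) + 1) / 2) in Hr2
    by (field; lra).
  lra.
Qed.

(** * Coefficient bounds from the Schwarz lemma *)

(** Let z tend to 0. *)
Lemma const_0_of_linear (c : C) (E : C -> C) :
  bounded_near E (RtoC 0) ->
  (forall z, unit_disk z -> z <> RtoC 0 -> (c + z * E z)%C = RtoC 0) -> c = RtoC 0.
Proof.
  intros (d & M & Hd & HM) H.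
  apply Cmod_eq_0, Rle_antisym; [|apply Cmod_ge_0].
  apply (le_0_of_linear _ M (Rmin d 1)); [apply Rmin_pos; lra|]; intros t Ht.
  pose proof (Rmin_l d 1); pose proof (Rmin_r d 1).
  assert (Et : Cmod t = t) by (rewrite Cmod_R, Rabs_pos_eq; lra).
  specialize (H t); specialize (HM t).
  replace c with (- (t * E t))%C.
  - rewrite Cmod_opp, Cmod_mult, Et, Rmult_comm.
    apply Rmult_le_compat_r; [lra|]; apply HM.
    replace (t - 0)%C with (RtoC t) by ring; lra.
  - transitivity ((c + t * E t) - t * E t)%C; [|ring].
    rewrite H; [ring|unfold unit_disk; lra|intro E0; apply RtoC_inj in E0; lra].
Qed.

Lemma jet_agree_at_0 (u v : C -> C) :
  jet 1 u (RtoC 0) -> jet 1 v (RtoC 0) ->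
  (forall z, unit_disk z -> z <> RtoC 0 -> u z = v z) -> u (RtoC 0) = v (RtoC 0).
Proof.
  intros (c & u1 & Hu & Eu) (e & v1 & Hv & Ev) H.
  assert (Hce : (c + (-1) * e)%C = RtoC 0).
  { apply (const_0_of_linear _ (fun z => u1 z + (-1) * v1 z)%C).
    - apply bounded_near_plus; [easy|].
      apply bounded_near_mult; [apply bounded_near_const|easy].
    - intros z Hz Hz0; specialize (H z Hz Hz0); rewrite Eu, Ev in H.
      transitivity ((c + (z - 0) * u1 z) + (-1) * (e + (z - 0) * v1 z))%C; [ring|].
      rewrite H; ring. }
  rewrite Eu, Ev; transitivity ((c + (-1) * e) + e)%C; [ring|rewrite Hce; ring].
Qed.

Lemma Cmod_le_of_sq (p q : C) : Cmod p ^ 2 <= Cmod q ^ 2 -> Cmod p <= Cmod q.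
Proof.
  intro H; pose proof (Cmod_ge_0 p); pose proof (Cmod_ge_0 q).
  apply Rnot_lt_le; intro Hlt; nra.
Qed.

Lemma Cconj_R (t : R) : Cconj t = t.
Proof. apply injective_projections; simpl; [easy|ring]. Qed.

Lemma pick_identity (a b : C) :
  Cmod (1 - Cconj a * b) ^ 2 - Cmod (b - a) ^ 2 = (1 - Cmod a ^ 2) * (1 - Cmod b ^ 2).
Proof.
  rewrite !Cmod2_alt; destruct a as [a1 a2], b as [b1 b2].
  unfold Re, Im; simpl; ring.
Qed.

(** The Schwarz lemma is applied to omega, which gives g = omega/z, and then to
    the composition of t g with the disk automorphism that sends t g(0) = t c1
    to 0.  The factor t < 1 keeps the denominator away from 0 even when
    |c1| = 1.  The result is t |c2| <= 1 - t^2 |c1|^2; then t tends to 1. *)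
Lemma schwarz_pick (omega : C -> C) :
  analytic_on_disk omega -> omega (RtoC 0) = RtoC 0 ->
  (forall z, unit_disk z -> unit_disk (omega z)) ->
  exists (c1 c2 : C) (w : C -> C),
    bounded_near w (RtoC 0) /\
    (forall z, omega z = z * (c1 + z * (c2 + z * w z)))%C /\
    (forall z, unit_disk z -> Cmod (omega z) <= Cmod z) /\
    Cmod c1 <= 1 /\ Cmod c2 <= 1 - Cmod c1 ^ 2.
Proof.
  intros Han H0 Hdisk.
  destruct (schwarz 4 omega) as (g & Hg & Eg & Hg1); [lia| | |easy|].
  { intros z Hz; now apply analytic_jet, Han. }
  { intros z Hz; now apply Rlt_le, Hdisk. }
  pose proof (Hg _ unit_disk_0) as J; destruct J as (c1 & g1 & Hg1j & E1).
  pose proof Hg1j as J; destruct J as (c2 & g2 & Hg2j & E2).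
  assert (Ec1 : g (RtoC 0) = c1) by (rewrite E1; ring).
  assert (Ec2 : g1 (RtoC 0) = c2) by (rewrite E2; ring).
  assert (Hc1 : Cmod c1 <= 1) by (rewrite <- Ec1; apply Hg1, unit_disk_0).
  pose proof (Cmod_ge_0 c1) as Hc10; pose proof (Cmod_ge_0 c2) as Hc20.
  exists c1, c2, g2; split; [now apply jet_bounded_near in Hg2j|].
  split; [intro z; rewrite Eg, E1, E2; ring|].
  split; [|split; [easy|]].
  { intros z Hz; rewrite Eg, Cmod_mult; specialize (Hg1 z Hz).
    pose proof (Cmod_ge_0 z); nra. }
  assert (Ht : forall t, 0 < t < 1 -> t * Cmod c2 <= 1 - t ^ 2 * Cmod c1 ^ 2).
  { intros t Ht.
    set (den := fun z => (1 + (- (t ^ 2 * Cconj c1)) * g z)%C).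
    assert (Et : Cmod t = t) by (rewrite Cmod_R, Rabs_pos_eq; lra).
    assert (Hden : forall z, unit_disk z -> den z <> RtoC 0).
    { intros z Hz Hz0; specialize (Hg1 z Hz); pose proof (Cmod_ge_0 (g z)).
      assert (E : RtoC 1 = (t ^ 2 * Cconj c1 * g z)%C).
      { transitivity (den z + t ^ 2 * Cconj c1 * g z)%C; [unfold den; ring|].
        rewrite Hz0; ring. }
      apply (f_equal Cmod) in E.
      rewrite Cmod_1, !Cmod_mult, Cmod_pow, Et, Cmod_conj in E.
      assert (Cmod c1 * Cmod (g z) <= 1) by nra. nra. }
    set (k := fun z => ((t * g z + - (t * c1)) * / den z)%C).
    destruct (schwarz 3 k) as (q & Hq & Eq & Hq1); [lia| | | |].
    - intros z Hz; apply jet_mult.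
      + apply jet_plus; [apply jet_mult; [apply jet_const|now apply Hg]|apply jet_const].
      + apply jet_inv; [|now apply Hden].
        apply jet_plus; [apply jet_const|].
        apply jet_mult; [apply jet_const|now apply Hg].
    - intros z Hz; unfold k; rewrite Cmod_mult, Cmod_inv by now apply Hden.
      assert (Hd : 0 < Cmod (den z)) by now apply Cmod_gt_0, Hden.
      apply (Rle_div_l _ _ _ Hd); rewrite Rmult_1_l.
      apply Cmod_le_of_sq.
      pose proof (pick_identity (t * c1) (t * g z)) as HP.
      replace (1 - Cconj (t * c1) * (t * g z))%C with (den z) in HP.
      2: { unfold den; rewrite Cmult_conj, Cconj_R; ring. }
      replace (t * g z - t * c1)%C with (t * g z + - (t * c1))%C in HP by ring.
      rewrite !Cmod_mult, Et in HP; specialize (Hg1 z Hz); pose proof (Cmod_ge_0 (g z)).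
      assert (0 <= (1 - (t * Cmod c1) ^ 2) * (1 - (t * Cmod (g z)) ^ 2)).
      { assert (t * Cmod c1 <= 1) by nra; assert (t * Cmod (g z) <= 1) by nra.
        assert (0 <= t * Cmod c1) by nra; assert (0 <= t * Cmod (g z)) by nra.
        apply Rmult_le_pos; nra. }
      lra.
    - unfold k; rewrite Ec1; ring.
    - assert (E0 : (t * g1 0 = q 0 * den 0)%C).
      { apply (jet_agree_at_0 (fun z => t * g1 z)%C (fun z => q z * den z)%C).
        - apply jet_mult; [apply jet_const|].
          now apply (jet_le 1 3); [lia|].
        - apply jet_mult; [apply (jet_le 1 3); [lia|apply Hq, unit_disk_0]|].
          apply jet_plus; [apply jet_const|].
          apply jet_mult; [apply jet_const|].
          apply (jet_le 1 4); [lia|apply Hg, unit_disk_0].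
        - intros z Hz Hz0.
          assert (Ek : (z * (t * g1 z) = z * (q z * den z))%C).
          { transitivity (k z * den z)%C.
            - unfold k; rewrite <- Cmult_assoc, Cinv_l, E1 by now apply Hden. ring.
            - rewrite Eq; ring. }
          transitivity (/ z * (z * (t * g1 z)))%C; [field; easy|].
          rewrite Ek; field; easy. }
      rewrite Ec2 in E0; apply (f_equal Cmod) in E0.
      rewrite !Cmod_mult, Et in E0.
      assert (Ed : den (RtoC 0) = RtoC (1 - t ^ 2 * Cmod c1 ^ 2)).
      { rewrite RtoC_minus, RtoC_mult, Cmod2_conj, RtoC_pow; unfold den.
        rewrite Ec1; ring. }
      assert (Hp : 0 <= 1 - t ^ 2 * Cmod c1 ^ 2).
      { assert (t ^ 2 <= 1) by nra; assert (Cmod c1 ^ 2 <= 1) by nra.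
        pose proof (pow2_ge_0 t); nra. }
      rewrite Ed, Cmod_R, Rabs_pos_eq in E0 by easy.
      specialize (Hq1 _ unit_disk_0); nra. }
  cut (Cmod c2 - (1 - Cmod c1 ^ 2) <= 0); [lra|].
  apply (le_0_of_linear _ (Cmod c2 + 2 * Cmod c1 ^ 2) 1); [lra|]; intros s Hs.
  specialize (Ht (1 - s) ltac:(lra)).
  pose proof (pow2_ge_0 (Cmod c1)); nra.
Qed.

Lemma psum_decr_3 (b : nat -> C) (z : C) :
  subgeometric b -> unit_disk z ->
  psum b z = (b 0%nat + z * (b 1%nat + z * (b 2%nat
     + z * psum (fun n => b (S (S (S n)))) z)))%C.
Proof.
  intros Hb Hz.
  pose proof (subgeometric_shift _ Hb) as Hb1.
  pose proof (subgeometric_shift _ Hb1) as Hb2.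
  now rewrite (psum_decr b z), (psum_decr _ z Hb1), (psum_decr _ z Hb2).
Qed.

Lemma psum_jet_0 (n : nat) (b : nat -> C) : subgeometric b -> jet n (psum b) (RtoC 0).
Proof.
  intro Hb; apply analytic_jet.
  exact (expansion_analytic _ _ (psum_expansion b Hb) _ unit_disk_0).
Qed.

(** The Schwarz lemma applied to (phi - 1)/(phi + 1), whose derivative at 0 is
    b_1 / 2. *)
Lemma coef1_le_2_of_Re_pos (phi : C -> C) (b : nat -> C) :
  expansion_on_disk phi b -> b 0%nat = RtoC 1 ->
  (forall z, unit_disk z -> 0 < Re (phi z)) -> Cmod (b 1%nat) <= 2.
Proof.
  intros Hphi Hb0 Hre.
  pose proof (expansion_subgeometric _ _ Hphi) as Hb.
  pose proof (subgeometric_shift _ Hb) as Hb1.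
  set (p := psum (fun n => b (S n))).
  assert (Ep : forall z, unit_disk z -> phi z = (1 + z * p z)%C).
  { intros z Hz; rewrite (expansion_psum _ _ z Hphi Hz), psum_decr, Hb0; easy. }
  assert (Ephi0 : phi (RtoC 0) = RtoC 1) by (rewrite Ep by apply unit_disk_0; ring).
  assert (Hj : forall n z, unit_disk z -> jet n phi z).
  { intros n z Hz; now apply analytic_jet, (expansion_analytic _ _ Hphi). }
  assert (Hden : forall z, unit_disk z -> (phi z + 1)%C <> RtoC 0).
  { intros z Hz E; specialize (Hre z Hz); apply (f_equal Re) in E.
    simpl in E; unfold Re in Hre; lra. }
  destruct (schwarz 3 (fun z => (phi z + -1) * / (phi z + 1))%C) as (q & Hq & Eq & Hq1).
  - lia.
  - intros z Hz; apply jet_mult.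
    + apply jet_plus; [now apply Hj|apply jet_const].
    + apply jet_inv; [|now apply Hden].
      apply jet_plus; [now apply Hj|apply jet_const].
  - intros z Hz; rewrite Cmod_mult, Cmod_inv by now apply Hden.
    assert (Hd : 0 < Cmod (phi z + 1)) by now apply Cmod_gt_0, Hden.
    apply (Rle_div_l _ _ _ Hd); rewrite Rmult_1_l.
    apply Cmod_le_of_sq.
    specialize (Hre z Hz); rewrite !Cmod2_alt; destruct (phi z) as [x y].
    unfold Re, Im in *; simpl in *; nra.
  - rewrite Ephi0; replace (1 + -1)%C with (RtoC 0) by ring; ring.
  - assert (E : (p 0 = q 0 * (phi 0 + 1))%C).
    { apply (jet_agree_at_0 p (fun z => q z * (phi z + 1))%C).
      - now apply psum_jet_0.
      - apply jet_mult; [apply (jet_le 1 3); [lia|apply Hq, unit_disk_0]|].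
        apply jet_plus; [apply Hj, unit_disk_0|apply jet_const].
      - intros z Hz Hz0.
        assert (Ez : (z * p z = z * (q z * (phi z + 1)))%C).
        { transitivity (z * q z * (phi z + 1))%C; [|ring].
          rewrite <- Eq, <- Cmult_assoc, Cinv_l by now apply Hden.
          rewrite Ep by easy; ring. }
        transitivity (/ z * (z * p z))%C; [field; easy|].
        rewrite Ez; field; easy. }
    assert (Ep0 : p (RtoC 0) = b 1%nat).
    { unfold p; rewrite (psum_decr _ _ Hb1 unit_disk_0); ring. }
    rewrite Ep0, Ephi0 in E; rewrite E, Cmod_mult.
    replace (1 + 1)%C with (RtoC 2) by (rewrite <- RtoC_plus; f_equal; ring).
    rewrite Cmod_R, Rabs_pos_eq by lra.
    specialize (Hq1 _ unit_disk_0); lra.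
Qed.

Ltac bounded_near_tac :=
  repeat first [assumption | apply bounded_near_const | apply (jet_id 0)
    | apply bounded_near_plus | apply bounded_near_mult].

(** Expand z f' = f (phi o omega) up to z^3 and compare the coefficients of z^2
    and z^3; the remainders stay bounded near 0. *)
Lemma S_star_coefficients (phi f : C -> C) (b a : nat -> C) :
  expansion_on_disk phi b -> b 0%nat = RtoC 1 ->
  S_star phi f -> expansion_on_disk f a ->
  exists c1 c2 : C,
    Cmod c1 <= 1 /\ Cmod c2 <= 1 - Cmod c1 ^ 2 /\
    a 2%nat = (b 1%nat * c1)%C /\
    a 3%nat = ((b 1%nat * c2 + (b 2%nat + b 1%nat ^ 2) * c1 ^ 2) / 2)%C.
Proof.
  intros Hphi Hb0 ((Hfan & Hf0 & Hf1) & Hfnz & (omega & Hoan & Ho0 & Hod & Ho)) Hf.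
  destruct (schwarz_pick omega Hoan Ho0 Hod) as (c1 & c2 & w & Hw & Ew & Hoz & Hc1 & Hc2).
  exists c1, c2; split; [easy|]; split; [easy|].
  pose proof (expansion_subgeometric _ _ Hphi) as Hb.
  pose proof (expansion_subgeometric _ _ Hf) as Ha.
  pose proof (subgeometric_deriv _ Ha) as Hda.
  assert (Ha0 : a 0%nat = RtoC 0).
  { rewrite <- Hf0, (expansion_psum _ _ _ Hf unit_disk_0), psum_decr;
      [ring|easy|apply unit_disk_0]. }
  assert (Ha1 : a 1%nat = RtoC 1).
  { rewrite <- (is_C_derive_unique _ _ _ Hf1).
    rewrite (is_C_derive_unique _ _ _ (is_derive_expansion _ _ _ Hf unit_disk_0)).
    rewrite (psum_decr _ _ Hda unit_disk_0); unfold deriv_coef at 1.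
    change (INR 1) with 1; ring. }
  set (r := psum (fun n => a (S (S (S (S n)))))).
  set (s := psum (fun n => deriv_coef a (S (S (S n))))).
  set (p := psum (fun n => b (S (S (S n))))).
  assert (Hr : bounded_near r (RtoC 0)).
  { apply (psum_jet_0 0); now do 4 apply subgeometric_shift in Ha. }
  assert (Hs : bounded_near s (RtoC 0)).
  { apply (psum_jet_0 0); now do 3 apply subgeometric_shift in Hda. }
  assert (Hp : bounded_near (fun z => p (omega z)) (RtoC 0)).
  { assert (Hp : bounded_near p (RtoC 0)).
    { apply (psum_jet_0 0); now do 3 apply subgeometric_shift in Hb. }
    destruct Hp as (d & M & Hd & HM).
    exists (Rmin d 1), M; split; [apply Rmin_pos; lra|]; intros z Hz; apply HM.
    replace (z - 0)%C with z in Hz by ring.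
    replace (omega z - 0)%C with (omega z) by ring.
    pose proof (Rmin_l d 1); pose proof (Rmin_r d 1).
    specialize (Hoz z ltac:(unfold unit_disk; lra)); lra. }
  assert (Ef : forall z, unit_disk z -> f z
     = (z * (1 + z * (a 2%nat + z * (a 3%nat + z * r z))))%C).
  { intros z Hz; rewrite (expansion_psum _ _ z Hf Hz), (psum_decr _ z Ha Hz).
    rewrite (psum_decr_3 _ z (subgeometric_shift _ Ha) Hz), Ha0, Ha1; fold r; ring. }
  assert (Edf : forall z, unit_disk z -> C_derive f z
     = (1 + z * (2 * a 2%nat + z * (3 * a 3%nat + z * s z)))%C).
  { intros z Hz; rewrite (is_C_derive_unique _ _ _ (is_derive_expansion _ _ z Hf Hz)).
    rewrite (psum_decr_3 _ z Hda Hz); fold s; unfold deriv_coef; rewrite Ha1.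
    change (INR 1) with 1; change (INR 2) with 2.
    replace (INR 3) with 3 by (simpl; ring); ring. }
  assert (Ephi : forall u, unit_disk u -> phi u
     = (1 + u * (b 1%nat + u * (b 2%nat + u * p u)))%C).
  { intros u Hu; rewrite (expansion_psum _ _ u Hphi Hu), (psum_decr_3 _ u Hb Hu), Hb0.
    reflexivity. }
  assert (Hode : forall z, unit_disk z -> z <> RtoC 0 ->
     ((1 + z * (a 2%nat + z * (a 3%nat + z * r z))) * phi (omega z) - C_derive f z)%C
     = RtoC 0).
  { intros z Hz Hz0; specialize (Ho z Hz); specialize (Hfnz z Hz Hz0).
    unfold log_derivative in Ho; destruct (Ceq_dec z (RtoC 0)) as [|_]; [easy|].
    rewrite <- Ho; rewrite (Ef z Hz) in Hfnz |- *.
    assert (H1 : (1 + z * (a 2%nat + z * (a 3%nat + z * r z)))%C <> RtoC 0).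
    { intro E; apply Hfnz; rewrite E; ring. }
    field; split; easy. }
  (* phi o omega = 1 + b1 z + b2 z^2 + T z^3, where omega = z W and W = c1 + z V. *)
  set (b1 := (b 1%nat * c1)%C).
  set (b2 := (b 1%nat * c2 + b 2%nat * c1 ^ 2)%C).
  set (V := fun z => (c2 + z * w z)%C).
  set (W := fun z => (c1 + z * V z)%C).
  set (T := fun z => (b 1%nat * w z + b 2%nat * (2 * c1 * V z + z * (V z * V z))
                      + W z * (W z * W z) * p (omega z))%C).
  assert (HV : bounded_near V (RtoC 0)) by (unfold V; bounded_near_tac).
  assert (HW : bounded_near W (RtoC 0)) by (unfold W; bounded_near_tac).
  assert (HT : bounded_near T (RtoC 0)) by (unfold T; bounded_near_tac).
  assert (ET : forall z, unit_disk z -> phi (omega z) = (1 + z * (b1 + z * (b2 + z * T z)))%C).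
  { intros z Hz; rewrite Ephi by now apply Hod.
    unfold T; generalize (p (omega z)); intro pz; rewrite Ew.
    unfold W, V, b1, b2; ring. }
  set (E2 := fun z => (r z + T z + a 2%nat * b2 + a 3%nat * b1
     + z * (a 2%nat * T z + a 3%nat * b2 + r z * b1)
     + z * (z * (a 3%nat * T z + r z * b2)) + z * (z * (z * (r z * T z))) + -1 * s z)%C).
  assert (HE2 : bounded_near E2 (RtoC 0)) by (unfold E2; bounded_near_tac).
  set (g1 := (b1 + -1 * a 2%nat)%C).
  set (g2 := (a 2%nat * b1 + b2 + -2 * a 3%nat)%C).
  assert (Hall : forall z, unit_disk z -> z <> RtoC 0 ->
     (g1 + z * (g2 + z * E2 z))%C = RtoC 0).
  { intros z Hz Hz0; specialize (Hode z Hz Hz0); rewrite ET, Edf in Hode by easy.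
    transitivity (/ z * (z * (g1 + z * (g2 + z * E2 z))))%C; [field; easy|].
    replace (z * (g1 + z * (g2 + z * E2 z)))%C with
     ((1 + z * (a 2%nat + z * (a 3%nat + z * r z))) * (1 + z * (b1 + z * (b2 + z * T z)))
      - (1 + z * (2 * a 2%nat + z * (3 * a 3%nat + z * s z))))%C.
    - rewrite Hode; ring.
    - unfold g1, g2, E2; ring. }
  assert (Hg1 : g1 = RtoC 0).
  { apply (const_0_of_linear _ (fun z => g2 + z * E2 z)%C); [bounded_near_tac|exact Hall]. }
  assert (Hg2 : g2 = RtoC 0).
  { apply (const_0_of_linear _ E2 HE2); intros z Hz Hz0.
    specialize (Hall z Hz Hz0); rewrite Hg1 in Hall.
    transitivity (/ z * (0 + z * (g2 + z * E2 z)))%C; [field; easy|].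
    rewrite Hall; ring. }
  assert (H2 : a 2%nat = b1).
  { transitivity (b1 - g1)%C; [unfold g1; ring|rewrite Hg1; ring]. }
  split; [exact H2|].
  assert (N2 : RtoC 2 <> RtoC 0) by (intro E; apply RtoC_inj in E; lra).
  transitivity ((a 2%nat * b1 + b2 - g2) / 2)%C; [unfold g2; field; easy|].
  rewrite Hg2, H2; unfold b1, b2; field; easy.
Qed.

(** * The determinants in terms of the coefficients *)

Lemma Re_detT21 (a : nat -> C) : Re (detT21 a) = 1 - Cmod (a 2%nat) ^ 2.
Proof. now rewrite detT21E. Qed.

(** Completing the square:
    |a3 - a2^2|^2 = |a3|^2 - 2 Re(a2^2 conj a3) + |a2|^4. *)
Lemma Re_detT31 (a : nat -> C) :
  Re (detT31 a) = (1 - Cmod (a 2%nat) ^ 2) ^ 2 - Cmod (a 3%nat - a 2%nat ^ 2) ^ 2.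
Proof.
  rewrite detT31E; change (Re (RtoC ?x)) with x.
  rewrite !Cmod2_alt; destruct (a 2%nat) as [x y], (a 3%nat) as [u v].
  unfold Re, Im; simpl; ring.
Qed.

(** The variable y stands for |a3 - a2^2| and v = m x - b (1 - x)/2 for its lower
    bound.  Where b^2 x <= 2 already (1 - b^2 x)^2 <= 1.  Elsewhere v >= 0 and
    it suffices that b^4 x^2 - 2 b^2 x <= v^2, an inequality between quadratic
    polynomials in x. *)
Lemma det_envelope_le_value_at_0 (b m x y : R) :
  0 < b <= 2 -> 0 <= m -> b ^ 4 - 2 * b ^ 2 < m ^ 2 ->
  0 <= x <= 1 -> 0 <= y -> m * x - b * (1 - x) / 2 <= y ->
  (1 - b ^ 2 * x) ^ 2 - y ^ 2 <= 1.
Proof.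
  intros Hb Hm HD Hx Hy Hv.
  destruct (Rle_or_lt (b ^ 2 * x) 2) as [H2|H2].
  { assert (0 <= b ^ 2 * x) by (apply Rmult_le_pos; [apply pow2_ge_0|lra]).
    pose proof (pow2_ge_0 y); nra. }
  assert (Hb2 : 2 < b ^ 2 <= 4) by (split; nra).
  set (n := m + b / 2).
  assert (Hmb : b * (b ^ 2 - 2) / 4 <= m).
  { apply Rnot_lt_le; intro Hlt.
    assert (m ^ 2 < (b * (b ^ 2 - 2) / 4) ^ 2) by nra.
    assert ((b * (b ^ 2 - 2) / 4) ^ 2 <= b ^ 2 * (b ^ 2 - 2)).
    { replace ((b * (b ^ 2 - 2) / 4) ^ 2) with (b ^ 2 * (b ^ 2 - 2) * ((b ^ 2 - 2) / 16))
        by field.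
      rewrite <- (Rmult_1_r (b ^ 2 * (b ^ 2 - 2))) at 2.
      apply Rmult_le_compat_l; nra. }
    nra. }
  assert (Hn : b ^ 3 <= 4 * n) by (unfold n; nra).
  set (v := n * x - b / 2).
  assert (Hvy : v <= y) by (unfold v, n; lra).
  assert (Hv0 : 0 <= v).
  { unfold v. assert (b ^ 3 * x <= 4 * n * x) by (apply Rmult_le_compat_r; lra).
    assert (b * 2 <= b * (b ^ 2 * x)) by (apply Rmult_le_compat_l; lra).
    replace (b * (b ^ 2 * x)) with (b ^ 3 * x) in * by ring. lra. }
  assert (Hq : b ^ 4 * x ^ 2 - 2 * b ^ 2 * x <= v ^ 2).
  { destruct (Rle_or_lt (n ^ 2) (b ^ 4)) as [Hc|Hc].
    - set (x2 := 2 / b ^ 2).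
      (* The difference of the two sides is concave in x, hence lies above its
         chord between x2, where b^2 x2 = 2, and 1; E is the exact formula. *)
      assert (Hx2 : b ^ 2 * x2 = 2) by (unfold x2; field; lra).
      assert (Hx2x : x2 <= x <= 1 /\ x2 < 1).
      { assert (b ^ 2 * x2 < b ^ 2 * x) by lra.
        assert (b ^ 2 * x2 < b ^ 2 * 1) by lra.
        repeat split; try lra; [apply Rlt_le|]; apply (Rmult_lt_reg_l (b ^ 2)); lra. }
      set (v2 := n * x2 - b / 2).
      assert (E : (1 - x2) * (v ^ 2 - (b ^ 4 * x ^ 2 - 2 * b ^ 2 * x))
        = (1 - x) * (v2 ^ 2 - b ^ 2 * x2 * (b ^ 2 * x2 - 2))
          + (x - x2) * (m ^ 2 - (b ^ 4 - 2 * b ^ 2))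
          + (b ^ 4 - n ^ 2) * ((x - x2) * (1 - x)) * (1 - x2)).
      { unfold v, v2, n; field. }
      rewrite Hx2 in E.
      assert (0 <= (1 - x) * (v2 ^ 2 - 2 * (2 - 2))).
      { apply Rmult_le_pos; [lra|]; pose proof (pow2_ge_0 v2); lra. }
      assert (0 <= (x - x2) * (m ^ 2 - (b ^ 4 - 2 * b ^ 2))) by (apply Rmult_le_pos; lra).
      assert (0 <= (b ^ 4 - n ^ 2) * ((x - x2) * (1 - x)) * (1 - x2)).
      { repeat apply Rmult_le_pos; lra. }
      apply Rnot_lt_le; intro Hlt; nra.
    - destruct (Rle_or_lt n (2 * b)) as [Hn2|Hn2].
      + unfold v.
        (* All three coefficients of the difference are nonnegative. *)
        assert (0 <= (n ^ 2 - b ^ 4) * x ^ 2)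
          by (apply Rmult_le_pos; [lra|apply pow2_ge_0]).
        assert (0 <= (2 * b - n) * b * x) by (apply Rmult_le_pos; nra).
        pose proof (pow2_ge_0 b); lra.
      + set (A := n ^ 2 - b ^ 4).
        (* The polynomial A x^2 - B x + b^2/4 has nonpositive discriminant, by
           n > 2 b and b <= 2. *)
        set (B := b * n - 2 * b ^ 2).
        assert (B ^ 2 <= A * b ^ 2).
        { assert (b ^ 3 <= 4 * b) by nra.
          assert (0 <= b ^ 3 * (4 * n - 4 * b - b ^ 3))
            by (apply Rmult_le_pos; [apply pow_le|]; lra).
          unfold A, B; nra. }
        assert (0 <= b ^ 2 * (A * x ^ 2 - B * x + b ^ 2 / 4)).
        { assert (0 <= (A * b ^ 2 - B ^ 2) * x ^ 2)
            by (apply Rmult_le_pos; [lra|apply pow2_ge_0]).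
          pose proof (pow2_ge_0 (B * x - b ^ 2 / 2)); nra. }
        assert (0 <= A * x ^ 2 - B * x + b ^ 2 / 4) by nra.
        unfold A, B, v in *; nra. }
  assert (v ^ 2 <= y ^ 2) by nra.
  nra.
Qed.

(** Where v = m x - b (1 - x)/2 is positive, the gap between the two sides with
    v for y factors as (1 - x) J(x) with J affine, and J is nonnegative at 0
    and at 1.  Where v <= 0, either b^2 x <= 2 and the left side is at most 1,
    or v <= 0 itself forces 1 - x to be large compared to m. *)
Lemma det_envelope_le_value_at_1 (b m x y : R) :
  0 < b <= 2 -> 0 <= m -> m ^ 2 <= b ^ 4 - 2 * b ^ 2 ->
  0 <= x <= 1 -> 0 <= y -> m * x - b * (1 - x) / 2 <= y ->
  (1 - b ^ 2 * x) ^ 2 - y ^ 2 <= (1 - b ^ 2) ^ 2 - m ^ 2.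
Proof.
  intros Hb Hm HD Hx Hy Hv.
  assert (Hb0 : 0 < b ^ 2) by (apply pow_lt; lra).
  assert (Hb4 : b ^ 2 <= 4) by nra.
  assert (Hb2 : 2 <= b ^ 2).
  { apply Rnot_lt_le; intro Hlt; pose proof (pow2_ge_0 m).
    assert (0 < b ^ 2 * (2 - b ^ 2)) by (apply Rmult_lt_0_compat; lra). lra. }
  assert (Hmb : m <= 2 * b).
  { assert (b ^ 2 * (b ^ 2 - 2) <= b ^ 2 * 2) by (apply Rmult_le_compat_l; lra).
    nra. }
  set (v := m * x - b * (1 - x) / 2) in *.
  destruct (Rle_or_lt v 0) as [Hv0|Hv0].
  - destruct (Rle_or_lt (b ^ 2 * x) 2) as [H2|H2].
    { assert (0 <= b ^ 2 * x) by (apply Rmult_le_pos; [apply pow2_ge_0|lra]).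
      pose proof (pow2_ge_0 y); nra. }
    assert (H1 : 2 * m * x <= b * (1 - x)) by (unfold v in Hv0; lra).
    assert (b ^ 3 * (2 * m * x) <= b ^ 3 * (b * (1 - x)))
      by (apply Rmult_le_compat_l; [apply pow_le; lra|easy]).
    assert (2 * b * m * 2 <= 2 * b * m * (b ^ 2 * x))
      by (apply Rmult_le_compat_l; [nra|lra]).
    assert (m ^ 2 <= 4 * b * m) by nra.
    assert (b ^ 4 * (1 - x) <= (1 - b ^ 2) ^ 2 - (1 - b ^ 2 * x) ^ 2).
    { replace ((1 - b ^ 2) ^ 2 - (1 - b ^ 2 * x) ^ 2)
        with (b ^ 4 * (1 - x) + b ^ 2 * (1 - x) * (b ^ 2 * x - 2)) by ring.
      assert (0 <= b ^ 2 * (1 - x) * (b ^ 2 * x - 2))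
        by (apply Rmult_le_pos; [apply Rmult_le_pos|]; lra).
      lra. }
    pose proof (pow2_ge_0 y); nra.
  - assert (v ^ 2 <= y ^ 2) by nra.
    set (n := m + b / 2).
    set (J := fun x => (b ^ 4 - n ^ 2) * (1 + x) - 2 * b ^ 2 + n * b).
    assert (J0 : 0 <= J 0) by (unfold J, n; nra).
    assert (J1 : 0 <= J 1) by (unfold J, n; nra).
    assert (Jx : 0 <= J x).
    { replace (J x) with ((1 - x) * J 0 + x * J 1) by (unfold J; ring). nra. }
    assert (E : (1 - b ^ 2) ^ 2 - m ^ 2 - ((1 - b ^ 2 * x) ^ 2 - v ^ 2) = (1 - x) * J x)
      by (unfold J, v, n; field).
    assert (0 <= (1 - x) * J x) by (apply Rmult_le_pos; lra).
    lra.
Qed.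

(** * Bounds and extremal functions *)

Lemma ma_minda_coefficients (phi : C -> C) (B : nat -> R) :
  ma_minda phi -> expansion_on_disk phi (fun n => RtoC (B n)) ->
  B 0%nat = 1 /\ 0 < B 1%nat <= 2.
Proof.
  intros Hmm Hphi.
  pose proof (expansion_subgeometric _ _ Hphi) as Hb.
  assert (HB0 : B 0%nat = 1).
  { apply RtoC_inj; rewrite <- (mm_at_0 _ Hmm).
    rewrite (expansion_psum _ _ _ Hphi unit_disk_0), (psum_decr _ _ Hb unit_disk_0); ring. }
  split; [exact HB0|].
  assert (Hpos : 0 < B 1%nat).
  { destruct (mm_derive_0 _ Hmm) as (d & Hd & Hder).
    replace (B 1%nat) with d; [easy|]; apply RtoC_inj.
    rewrite <- (is_C_derive_unique _ _ _ Hder).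
    rewrite (is_C_derive_unique _ _ _ (is_derive_expansion _ _ _ Hphi unit_disk_0)).
    rewrite (psum_decr _ _ (subgeometric_deriv _ Hb) unit_disk_0).
    unfold deriv_coef at 1; change (INR 1) with 1; ring. }
  split; [exact Hpos|].
  pose proof (coef1_le_2_of_Re_pos phi _ Hphi (f_equal RtoC HB0) (mm_Re_pos _ Hmm)) as H.
  cbv beta in H; now rewrite Cmod_R, Rabs_pos_eq in H by lra.
Qed.

(** 2 (a3 - a2^2) = B1 c2 + (B2 - B1^2) c1^2, where |c2| <= 1 - |c1|^2; here
    x = |c1|^2. *)
Lemma S_star_detT31 (phi f : C -> C) (B : nat -> R) (a : nat -> C) :
  ma_minda phi -> expansion_on_disk phi (fun n => RtoC (B n)) ->
  S_star phi f -> expansion_on_disk f a ->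
  exists x y : R,
    Cmod (a 2%nat) ^ 2 = B 1%nat ^ 2 * x /\ Cmod (a 3%nat - a 2%nat ^ 2) = y /\
    0 <= x <= 1 /\ 0 <= y /\
    Rabs (B 1%nat ^ 2 - B 2%nat) / 2 * x - B 1%nat * (1 - x) / 2 <= y.
Proof.
  intros Hmm Hphi Hf Ha.
  destruct (ma_minda_coefficients phi B Hmm Hphi) as [HB0 HB1].
  destruct (S_star_coefficients phi f _ a Hphi (f_equal RtoC HB0) Hf Ha)
    as (c1 & c2 & Hc1 & Hc2 & E2 & E3).
  pose proof (Cmod_ge_0 c1) as Hc10.
  exists (Cmod c1 ^ 2), (Cmod (a 3%nat - a 2%nat ^ 2)).
  split; [|split; [easy|split; [nra|split; [apply Cmod_ge_0|]]]].
  { rewrite E2, Cmod_mult, Cmod_R, Rpow_mult_distr, pow2_abs; ring. }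
  set (D := (a 3%nat - a 2%nat ^ 2)%C).
  assert (ED : (RtoC (B 2%nat - B 1%nat ^ 2) * c1 ^ 2)%C = (2 * D + - (B 1%nat * c2))%C).
  { unfold D; rewrite E2, E3, RtoC_minus, RtoC_pow; field. }
  apply (f_equal Cmod) in ED.
  rewrite Cmod_mult, Cmod_pow, Cmod_R in ED.
  pose proof (Cmod_triangle (2 * D) (- (B 1%nat * c2))) as HT.
  rewrite <- ED, Cmod_opp, !Cmod_mult, !Cmod_R, (Rabs_pos_eq 2), (Rabs_pos_eq (B 1%nat)) in HT
    by lra.
  rewrite (Rabs_minus_sym (B 1%nat ^ 2)).
  nra.
Qed.

Definition affine_coef (u v : C) (n : nat) : C :=
  match n with O => u | 1%nat => v | _ => RtoC 0 end.

Lemma expansion_affine (u v : C) :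
  expansion_on_disk (fun z => u + v * z)%C (affine_coef u v).
Proof.
  intros z _; apply is_pseries_C.
  apply is_series_decr_1, is_series_decr_1.
  replace (plus _ _) with (RtoC 0).
  - eapply is_series_C_ext; [|exact is_series_C_0]; intro n; simpl; ring.
  - change (RtoC 0 = (u + v * z) + - (u * 1) + - (v * (z * 1)))%C; ring.
Qed.

(** Take omega(z) = z. *)
Lemma S_star_extremal (phi : C -> C) (B : nat -> R) :
  ma_minda phi -> expansion_on_disk phi (fun n => RtoC (B n)) ->
  exists (f : C -> C) (a : nat -> C),
    S_star phi f /\ expansion_on_disk f a /\
    a 2%nat = RtoC (B 1%nat) /\ a 3%nat = RtoC ((B 2%nat + B 1%nat ^ 2) / 2).
Proof.
  intros Hmm Hphi.
  destruct (ma_minda_coefficients phi B Hmm Hphi) as [HB0 HB1].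
  destruct (exists_with_log_derivative phi _ Hphi (f_equal RtoC HB0))
    as (f & a & HA & Hnz & Hlog & Hfa & E2 & E3).
  exists f, a; split; [|split; [easy|split; [easy|]]].
  - split; [easy|split; [easy|]].
    exists (fun z => z); split; [|split; [easy|split; [easy|exact Hlog]]].
    intros z Hz.
    destruct (expansion_analytic _ _ (expansion_affine 0 1) z Hz) as (c & r & Hr & H).
    exists c, r; split; [easy|]; intros w Hw; specialize (H w Hw).
    now replace (0 + 1 * w)%C with w in H by ring.
  - rewrite E3, RtoC_div, RtoC_plus, RtoC_pow by lra; easy.
Qed.

(** Take omega = 0, that is f(z) = z, obtained as the function with z f'/f = 1. *)
Lemma S_star_identity (phi : C -> C) :
  ma_minda phi ->
  exists (f : C -> C) (a : nat -> C),
    S_star phi f /\ expansion_on_disk f a /\ a 2%nat = RtoC 0 /\ a 3%nat = RtoC 0.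
Proof.
  intros Hmm.
  destruct (exists_with_log_derivative _ _ (expansion_affine 1 0) eq_refl)
    as (f & a & HA & Hnz & Hlog & Hfa & E2 & E3).
  exists f, a; split; [|split; [easy|split; [easy|]]].
  - split; [easy|split; [easy|]].
    exists (fun z => 0 + 0 * z)%C; split; [|split; [|split]].
    + exact (expansion_analytic _ _ (expansion_affine 0 0)).
    + ring.
    + intros z _; replace (0 + 0 * z)%C with (RtoC 0) by ring; apply unit_disk_0.
    + intros z Hz; rewrite Hlog by easy.
      replace (0 + 0 * z)%C with (RtoC 0) by ring; rewrite (mm_at_0 _ Hmm); ring.
  - rewrite E3; simpl; field.
Qed.

Theorem theorem2 :
  forall (phi : C -> C) (B : nat -> R),
    ma_minda phi ->
    expansion_on_disk phi (fun n => RtoC (B n)) ->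
    (* (1) *)
    ((forall (f : C -> C) (a : nat -> C),
        S_star phi f -> expansion_on_disk f a ->
        1 - B 1%nat ^ 2 <= Re (detT21 a) <= 1) /\
     (exists (f : C -> C) (a : nat -> C),
        S_star phi f /\ expansion_on_disk f a /\
        Re (detT21 a) = 1 - B 1%nat ^ 2) /\
     (exists (f : C -> C) (a : nat -> C),
        S_star phi f /\ expansion_on_disk f a /\
        Re (detT21 a) = 1)) /\
    (* (2) *)
    (3 * B 1%nat ^ 4 - 8 * B 1%nat ^ 2 + 2 * B 1%nat ^ 2 * B 2%nat - B 2%nat ^ 2 < 0 ->
     B 1%nat <= Rabs (B 2%nat + B 1%nat ^ 2) ->
     (forall (f : C -> C) (a : nat -> C),
        S_star phi f -> expansion_on_disk f a ->
        Re (detT31 a) <= 1) /\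
     (exists (f : C -> C) (a : nat -> C),
        S_star phi f /\ expansion_on_disk f a /\
        Re (detT31 a) = 1)) /\
    (* (3) *)
    (3 * B 1%nat ^ 4 - 8 * B 1%nat ^ 2 + 2 * B 1%nat ^ 2 * B 2%nat - B 2%nat ^ 2 >= 0 ->
     B 1%nat <= Rabs (B 2%nat + B 1%nat ^ 2) ->
     (forall (f : C -> C) (a : nat -> C),
        S_star phi f -> expansion_on_disk f a ->
        Re (detT31 a) <=
          B 1%nat ^ 2 * (B 1%nat ^ 2 + B 2%nat)
          - 1 / 4 * (B 1%nat ^ 2 + B 2%nat) ^ 2 - 2 * B 1%nat ^ 2 + 1) /\
     (exists (f : C -> C) (a : nat -> C),
        S_star phi f /\ expansion_on_disk f a /\
        Re (detT31 a) =
          B 1%nat ^ 2 * (B 1%nat ^ 2 + B 2%nat)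
          - 1 / 4 * (B 1%nat ^ 2 + B 2%nat) ^ 2 - 2 * B 1%nat ^ 2 + 1)).
Proof.
  intros phi B Hmm Hphi.
  destruct (ma_minda_coefficients phi B Hmm Hphi) as [_ HB1].
  destruct (S_star_identity phi Hmm) as (fi & ai & Hfi & Hai & Ei2 & Ei3).
  destruct (S_star_extremal phi B Hmm Hphi) as (fe & ae & Hfe & Hae & Ee2 & Ee3).
  set (m := Rabs (B 1%nat ^ 2 - B 2%nat) / 2).
  assert (Hm : 0 <= m) by (unfold m; pose proof (Rabs_pos (B 1%nat ^ 2 - B 2%nat)); lra).
  assert (Hm2 : m ^ 2 = (B 1%nat ^ 2 - B 2%nat) ^ 2 / 4).
  { unfold m; rewrite <- (pow2_abs (B 1%nat ^ 2 - B 2%nat)); field. }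
  assert (Hid : Re (detT31 ai) = 1).
  { rewrite Re_detT31, Ei2, Ei3.
    replace (0 - 0 ^ 2)%C with (RtoC 0) by ring; rewrite Cmod_0; ring. }
  split; [split; [|split]|split; intros HD _; split].
  - intros f a Hf Ha; rewrite Re_detT21.
    destruct (S_star_detT31 phi f B a Hmm Hphi Hf Ha) as (x & y & -> & _ & Hx & _).
    pose proof (pow2_ge_0 (B 1%nat)); nra.
  - exists fe, ae; split; [easy|split; [easy|]].
    now rewrite Re_detT21, Ee2, Cmod_R, pow2_abs.
  - exists fi, ai; split; [easy|split; [easy|]].
    rewrite Re_detT21, Ei2, Cmod_0; ring.
  - intros f a Hf Ha; rewrite Re_detT31.
    destruct (S_star_detT31 phi f B a Hmm Hphi Hf Ha) as (x & y & -> & -> & Hx & Hy & Hv).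
    apply (det_envelope_le_value_at_0 _ m); try easy; lra.
  - exists fi, ai; easy.
  - intros f a Hf Ha; rewrite Re_detT31.
    destruct (S_star_detT31 phi f B a Hmm Hphi Hf Ha) as (x & y & -> & -> & Hx & Hy & Hv).
    eapply Rle_trans; [apply (det_envelope_le_value_at_1 _ m); try easy; lra|].
    rewrite Hm2; apply Req_le; field.
  - exists fe, ae; split; [easy|split; [easy|]].
    rewrite Re_detT31, Ee2, Ee3.
    rewrite <- RtoC_pow, <- RtoC_minus, !Cmod_R, !pow2_abs; field.
Qed.
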